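(* For all $M>0$, $R>0$ and $d\in\mathbb{N}^*$ there exists $C>0$ such that the following holds. Let $\mu,\nu$ be probability measures on $\mathbb{R}^d$ supported in $B_R$, such that $\mu$ has a density with respect to Lebesgue measure upper bounded by $M$, and $\nu=\sum_{j=1}^m b_j\delta_{y_j}$ for some fixed integer $m>1$, support points $y_1,\ldots,y_m\in\mathbb{R}^d$ and weights $b_1,\ldots,b_m>0$ with $\sum_{j=1}^m b_j=1$. For a positive integer $n$, let $X_1,\ldots,X_n$ be i.i.d. random samples distributed according to $\mu$ and $\hat\mu_n=\frac1n\sum_{i=1}^n\delta_{X_i}$. Let $\bar\varphi$ be an optimal Brenier potential for $(\mu,\nu)$ and let $\hat T_n$ be the Monge map estimator (defined in the context) for the discrete measures $\hat\mu_n$ and $\nu$. Then $$\mathbb{E}\left[\int_{\mathbb{R}^d}\|\nabla\bar\varphi(x)-\hat T_n(x)\|\,d\mu(x)\right]\le C\left(\frac mn\right)^{\frac18}.$$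
   Context: $B_R$ is the open Euclidean ball of $\mathbb{R}^d$ centered at $0$ with radius $R$. $\Gamma_0(\mathbb{R}^d)$ is the set of proper lower semicontinuous convex functions $\mathbb{R}^d\to\mathbb{R}\cup\{+\infty\}$; $\varphi^*(y)=\sup_{x}\langle x,y\rangle-\varphi(x)$; $\partial\varphi$ is the convex subdifferential. An optimal Brenier potential for a pair $(\mu,\nu)$ of compactly supported probability measures is a function $\varphi\in\Gamma_0(\mathbb{R}^d)$ attaining $\inf_{\varphi\in\Gamma_0(\mathbb{R}^d)}\int\varphi\,d\mu+\int\varphi^*\,d\nu$. Monge map estimator. For discrete measures $\hat\mu=\sum_{i=1}^n a_i\delta_{x_i}$, $\hat\nu=\sum_{j=1}^m b_j\delta_{y_j}$ with positive weights summing to one, let $(f,g)\in\mathbb{R}^n\times\mathbb{R}^m$ be an optimal solution of the dual discrete optimal transport problem $\max\{\langle f,a\rangle+\langle g,b\rangle \mid f\in\mathbb{R}^n, g\in\mathbb{R}^m, f_i+g_j\le\frac12\|x_i-y_j\|^2\ \forall i,j\}$, and set $\varphi_g(x)=\max_{k=1,\ldots,m}\langle x,y_k\rangle+g_k-\frac12\|y_k\|^2$. The estimator is any selection $\hat T:\mathbb{R}^d\to\mathbb{R}^d$ with $\hat T(x)\in\partial\varphi_g(x)$ for all $x\in\mathbb{R}^d$; for example $\hat T(x)=\frac{1}{|I(x)|}\sum_{j\in I(x)}y_j$ with $I(x)=\{j\mid\varphi_g(x)=\langle x,y_j\rangle+g_j-\frac12\|y_j\|^2\}$. Here it is applied with $x_i=X_i$,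 $a_i=1/n$, and $\hat\nu=\nu$. *)

(* Defs.v *)
From HB Require Import structures.
From mathcomp Require Import all_boot all_order all_algebra.
From mathcomp Require Import all_classical all_reals all_analysis.

Set Implicit Arguments.
Unset Strict Implicit.
Unset Printing Implicit Defensive.

Import Order.TTheory GRing.Theory Num.Theory.
Import numFieldNormedType.Exports.

Local Open Scope classical_set_scope.
Local Open Scope ring_scope.

(* The space R^d is 'rV[R]_d. Its library topology comes from the sup norm
   (hence is the usual one); it carries no sigma-algebra in the library. We give
   it the product sigma-algebra, generated by the coordinate projections, as the
   library does for n.-tuple T; over R this is the Borel sigma-algebra. *)
Definition measure_rV_display : measure_display -> measure_display.
Proof. exact. Qed.

Section measurable_rV.
Context {R : realType}.
Variable n : nat.

Let coors : 'I_n -> 'rV[R]_n -> R := fun i x => x ord0 i.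

Let rV_set0 : g_sigma_preimage coors set0.
Proof. exact: sigma_algebra0. Qed.

Let rV_setC A : g_sigma_preimage coors A -> g_sigma_preimage coors (~` A).
Proof. exact: sigma_algebraC. Qed.

Let rV_bigcup (F : (set 'rV[R]_n)^nat) :
  (forall i, g_sigma_preimage coors (F i)) ->
  g_sigma_preimage coors (\bigcup_i (F i)).
Proof. exact: sigma_algebra_bigcup. Qed.

HB.instance Definition _ :=
  @isMeasurable.Build (measure_rV_display R.-ocitv.-measurable.-sigma)
    'rV[R]_n (g_sigma_preimage coors) rV_set0 rV_setC rV_bigcup.

End measurable_rV.

Section measurable_fun_rV.
Context {R : realType} {d : measure_display} {T : measurableType d}.

Lemma measurable_fun_coord n (i : 'I_n) :
  measurable_fun [set: 'rV[R]_n] (fun x => x ord0 i).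
Proof.
move=> _ Y mY; rewrite setTI; apply: sub_sigma_algebra => /=.
rewrite -bigcup_seq/=; exists i => /=; first by rewrite mem_index_enum.
by exists Y => //; rewrite setTI.
Qed.

Lemma measurable_fun_rV n (f : T -> 'rV[R]_n) :
  (forall i, measurable_fun [set: T] (fun x => f x ord0 i)) ->
  measurable_fun [set: T] f.
Proof.
move=> mf.
suff sub : g_sigma_preimage (fun i x => f x ord0 i) `<=` measurable.
  move=> _ A mA; apply: sub.
  by rewrite (g_sigma_preimage_comp (fun i (x : 'rV[R]_n) => x ord0 i));
    exists A.
apply: smallest_sub; first exact: sigma_algebra_measurable.
case: n => [|n] in f mf *; first by rewrite big_ord0.
rewrite -bigcup_mkord_ord; apply: bigcup_sub => i Ii.
by move=> A [B mB <-]; exact: mf.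
Qed.

End measurable_fun_rV.

Section lebesgue_rV.
Context {R : realType}.
Local Open Scope ereal_scope.

Definition rV_cons n (p : measurableTypeR R * 'rV[R]_n) : 'rV[R]_n.+1 :=
  \row_i (if unlift ord0 i is Some j then p.2 ord0 j else p.1).

Lemma measurable_rV_cons n : measurable_fun setT (@rV_cons n).
Proof.
apply: measurable_fun_rV => i; rewrite /rV_cons.
under eq_fun do rewrite mxE.
case: (unliftP ord0 i) => [j|] _; last exact: measurable_fst.
exact: (measurableT_comp (measurable_fun_coord j) measurable_snd).
Qed.

Section step.
Variable n : nat.
Variable mu : {sigma_finite_measure set 'rV[R]_n -> \bar R}.

Definition lebesgue_rV_step : set 'rV[R]_n.+1 -> \bar R :=
  pushforward (lebesgue_measure \x mu) (@rV_cons n).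

Let step0 : lebesgue_rV_step set0 = 0.
Proof. by rewrite /lebesgue_rV_step /pushforward preimage_set0 measure0. Qed.

Let step_ge0 A : 0 <= lebesgue_rV_step A.
Proof. exact: (measure_ge0 (lebesgue_measure \x mu)). Qed.

Let step_sigma_additive : semi_sigma_additive lebesgue_rV_step.
Proof.
move=> F mF tF mUF; rewrite /lebesgue_rV_step /pushforward preimage_bigcup.
apply: (@measure_semi_sigma_additive _ _ _ (lebesgue_measure \x mu)).
- by move=> k; rewrite -[X in measurable X]setTI; exact: measurable_rV_cons.
- apply/trivIsetP => /= i j _ _ ij; rewrite -preimage_setI.
  by move/trivIsetP : tF => /(_ _ _ _ _ ij) ->//; rewrite preimage_set0.
- by rewrite -preimage_bigcup -[X in measurable X]setTI;
    exact: measurable_rV_cons.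
Qed.

HB.instance Definition _ := isMeasure.Build _ _ _ lebesgue_rV_step
  step0 step_ge0 step_sigma_additive.

Lemma lebesgue_rV_step_sigma_finite : sigma_finite setT lebesgue_rV_step.
Proof.
have /sigma_finiteP[F [TF ndF Foo]] := sigma_finiteT (@lebesgue_measure R).
have /sigma_finiteP[G [TG ndG Goo]] := sigma_finiteT mu.
have UFG : \bigcup_k (F k `*` G k) = setT.
  rewrite -subTset => -[x v] _.
  have [i _ Fx] : (\bigcup_i F i) x by rewrite -TF.
  have [j _ Gv] : (\bigcup_i G i) v by rewrite -TG.
  exists (maxn i j) => //; split => /=.
    by move: x Fx; exact/subsetPset/ndF/leq_maxl.
  by move: v Gv; exact/subsetPset/ndG/leq_maxr.
pose g (v : 'rV[R]_n.+1) : measurableTypeR R * 'rV[R]_n :=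
  (v ord0 ord0, \row_j v ord0 (lift ord0 j)).
have gK : cancel (@rV_cons n) g.
  move=> [x v]; rewrite /g /rV_cons mxE unlift_none; congr pair.
  by apply/rowP => j; rewrite !mxE liftK.
have mg : measurable_fun setT g.
  apply/measurable_fun_pairP; split; first exact: measurable_fun_coord.
  apply: measurable_fun_rV => i; under eq_fun do rewrite /= mxE.
  exact: measurable_fun_coord.
exists (fun k => g @^-1` (F k `*` G k)).
  by rewrite -preimage_bigcup UFG preimage_setT.
move=> k; have [? ?] := Foo k; have [? ?] := Goo k; split.
  by rewrite -[X in measurable X]setTI; apply: mg => //; exact: measurableX.
rewrite /lebesgue_rV_step /pushforward (_ : _ @^-1` _ = F k `*` G k).
  by rewrite product_measure1E// lte_mul_pinfty// ge0_fin_numE.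
by rewrite -comp_preimage (_ : g \o _ = id) ?preimage_id//; apply/funext.
Qed.

HB.instance Definition _ := Measure_isSigmaFinite.Build _ _ _
  lebesgue_rV_step lebesgue_rV_step_sigma_finite.

End step.

(* Iterated product of the one-dimensional Lebesgue measure, one coordinate at a
   time; 'rV[R]_0 is a point, of mass 1. *)
Fixpoint lebesgue_rV n : {sigma_finite_measure set 'rV[R]_n -> \bar R} :=
  if n isn't n'.+1 then dirac (0%R : 'rV[R]_0)
  else lebesgue_rV_step (lebesgue_rV n').

End lebesgue_rV.

Section euclidean_space.
Context {R : realType} {d : nat}.
Implicit Types x y : 'rV[R]_d.

Definition dotrV x y : R := \sum_(i < d) x ord0 i * y ord0 i.

(* The library norm `|x| on 'rV[R]_d is the sup norm. *)
Definition enorm x : R := Num.sqrt (dotrV x x).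

Definition eball (r : R) : set 'rV[R]_d := [set x | enorm x < r].

End euclidean_space.

Definition is_density {R : realType} {d : nat}
    (mu : set 'rV[R]_d -> \bar R) (rho : 'rV[R]_d -> R) : Prop :=
  [/\ measurable_fun setT rho, forall x, 0 <= rho x &
      forall A, measurable A ->
        mu A = (\int[lebesgue_rV d]_(x in A) (rho x)%:E)%E].

Section convex_analysis.
Context {R : realType} {d : nat}.
Implicit Types phi : 'rV[R]_d -> \bar R.
Local Open Scope ereal_scope.

Definition proper_fun phi : Prop :=
  (forall x, phi x != -oo) /\ (exists x, phi x < +oo).

Definition convex_efun phi : Prop :=
  forall (x y : 'rV[R]_d) (t : R), (0 <= t <= 1)%R ->
    phi (t *: x + (1 - t) *: y)%R <= t%:E * phi x + (1 - t)%:E * phi y.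

Definition Gamma0 : set ('rV[R]_d -> \bar R) :=
  [set phi | [/\ proper_fun phi, lower_semicontinuous phi & convex_efun phi]].

Definition conjugate phi (y : 'rV[R]_d) : \bar R :=
  ereal_sup [set (dotrV x y)%:E - phi x | x in setT].

Definition subdifferential phi (x : 'rV[R]_d) : set 'rV[R]_d :=
  [set p | forall z, phi x + (dotrV p (z - x)%R)%:E <= phi z].

(* Vector of partial derivatives of the finite part of [phi]; it is the gradient
   wherever [phi] is finite near [x] and differentiable at [x], and a junk value
   elsewhere. *)
Definition grad phi (x : 'rV[R]_d) : 'rV[R]_d :=
  (\row_i ('D_(delta_mx ord0 i) (fine \o phi) x : R))%R.

Definition brenier_functional (mu nu : set 'rV[R]_d -> \bar R) phi : \bar R :=
  \int[mu]_x phi x + \int[nu]_y conjugate phi y.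

Definition optimal_brenier_potential (mu nu : set 'rV[R]_d -> \bar R) phi :
  Prop :=
  Gamma0 phi /\
  brenier_functional mu nu phi =
    ereal_inf [set brenier_functional mu nu psi | psi in Gamma0].

End convex_analysis.

Section monge_map_estimator.
Context {R : realType} {d n m : nat}.
Variables (a : 'I_n -> R) (x : 'I_n -> 'rV[R]_d).
Variables (b : 'I_m -> R) (y : 'I_m -> 'rV[R]_d).

Definition dual_feasible (f : 'I_n -> R) (g : 'I_m -> R) : Prop :=
  forall i j, f i + g j <= 2^-1 * enorm (x i - y j) ^+ 2.

Definition dual_value (f : 'I_n -> R) (g : 'I_m -> R) : R :=
  \sum_(i < n) f i * a i + \sum_(j < m) g j * b j.

Definition dual_optimal (f : 'I_n -> R) (g : 'I_m -> R) : Prop :=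
  dual_feasible f g /\
  forall f' g', dual_feasible f' g' -> dual_value f' g' <= dual_value f g.

(* Real-valued as soon as 0 < m. *)
Definition potential_of_dual (g : 'I_m -> R) (z : 'rV[R]_d) : \bar R :=
  \big[maxe/-oo%E]_(k < m)
    (dotrV z (y k) + g k - 2^-1 * enorm (y k) ^+ 2)%:E.

(* [T] is one of the possible estimators: both the dual solution (f, g) and the
   selection of a subgradient are arbitrary. *)
Definition monge_map_estimator (T : 'rV[R]_d -> 'rV[R]_d) : Prop :=
  exists f g, dual_optimal f g /\
    forall z, subdifferential (potential_of_dual g) z (T z).

End monge_map_estimator.

Section iid.
Context {dO dT : measure_display} {Omega : measurableType dO}.
Context {T : measurableType dT} {R : realType}.
Variable P : probability Omega R.

Definition mutually_independent n (X : 'I_n -> {RV P >-> T}) : Prop :=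
  forall (J : {set 'I_n}) (A : 'I_n -> set T),
    (forall i, measurable (A i)) ->
    P (\bigcap_(i in [set` J]) (X i @^-1` A i)) =
    (\prod_(i in J) P (X i @^-1` A i))%E.

Definition iid_sample (mu : set T -> \bar R) n (X : 'I_n -> {RV P >-> T}) :
  Prop :=
  mutually_independent X /\
  forall i A, measurable A -> distribution P (X i) A = mu A.

End iid.

(* Main.v *)
Require Import Defs.
From mathcomp Require Import all_boot all_order all_algebra.
From mathcomp Require Import all_classical all_reals all_analysis.
From mathcomp Require Import measurable_realfun ring lra.

Set Implicit Arguments.
Unset Strict Implicit.
Unset Printing Implicit Defensive.

Import Order.TTheory GRing.Theory Num.Theory.
Import numFieldNormedType.Exports.

Local Open Scope classical_set_scope.
Local Open Scope ring_scope.

(**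
Write phi_psi for the maximum over k of the affine functions
<x, y_k> + psi_k. Against a discrete nu, potentials may be replaced by such
functions: with psi_k = - phi^*(y_k), Fenchel's inequality gives
phi_psi <= phi while the dual term does not grow, so an optimal phi equals
phi_psi mu-almost everywhere and psi minimises the semi-dual objective
J(psi) = int phi_psi dmu - sum_k b_k psi_k
([optimal_potential_max_affine]). Likewise the weights of an optimal discrete
dual solution minimise the same objective J_n with the empirical mean in place
of mu ([dual_optimal_minimiser]). The proof compares the two minimisers psi
and psi'.

Stability. The midpoint of psi and psi' competes with psi, so the integral of
the Jensen gap phi_psi + phi_psi' - 2 phi_mid is at most the excess
J(psi') - J(psi) ([integral_jensen_gap_le]). If y_k is active at x for the
midpoint, it is an approximate subgradient at x of both phi_psi and phi_psi',
with errors adding up to the gap. An approximate subgradient with error e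
differs from a true one, in coordinate i, by at most (e + D_i) / h, where D_i
is the second difference of the function in direction i with step h
([subgradient_dist]). Along a line D_i is a difference of two shifts of a
bounded monotone function, so its integral telescopes to O(h^2); the density
bound and Fubini turn this into a bound for mu ([integral_second_diff_le]).
Altogether the distance between the two maps is at most C (excess / h + h) for
every h > 0 ([map_stability]).

Statistics. As psi' minimises J_n, the excess is at most the deviation of the
empirical mean from the mu-mean on phi_psi' - phi_psi. Minimality forces
the entries of each of psi and psi' to lie within 2 d r^2 of each other
([minimiser_oscillation]), so up to a constant psi' lies in a box of dimension
m, which a grid of mesh sigma^2, with sigma^8 = m / n, covers by exp (m G)
points, G of order sigma^-2. A union bound on exponential moments
([empirical_process_bound]) bounds the expected supremum over the grid by a
multiple of sigma^2. With h = sigma the error is of order sigma. A deviation of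
order (m / n)^(1/4) is enough because stability has exponent 1/2; this leaves
room for crude covering bounds.

Gradients. The set where phi touches the affine function of index k is convex,
hence its slice along a coordinate line is an interval, which has at most two
edge points; by Fubini the edge points are mu-null. Away from them phi is
affine on a short segment in every coordinate direction, so its partial
derivatives are the coordinates of y_k ([grad_max_affine_ae]).
*)

(** * Maxima of finitely many affine functions *)

Section coordinates.
Context {R : realType} {d : nat}.
Implicit Types (x y z : 'rV[R]_d) (i : 'I_d).

Lemma dotrVDl x z y : dotrV (x + z) y = dotrV x y + dotrV z y.
Proof.
by rewrite /dotrV -big_split; apply: eq_bigr => i _; rewrite mxE mulrDl.
Qed.

Lemma dotrVZl (c : R) x y : dotrV (c *: x) y = c * dotrV x y.
Proof.
by rewrite /dotrV big_distrr; apply: eq_bigr => i _; rewrite mxE -mulrA.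
Qed.

Lemma dotrVC x y : dotrV x y = dotrV y x.
Proof. by apply: eq_bigr => i _; rewrite mulrC. Qed.

Lemma dotrVNl x y : dotrV (- x) y = - dotrV x y.
Proof. by rewrite -scaleN1r dotrVZl mulN1r. Qed.

Lemma dotrV_delta i y : dotrV (delta_mx ord0 i) y = y ord0 i.
Proof.
rewrite /dotrV (bigD1 i)//= mxE !eqxx mul1r big1 ?addr0// => j ji.
by rewrite mxE eqxx (negbTE ji) mul0r.
Qed.

Lemma coord_le_enorm x i : `|x ord0 i| <= enorm x.
Proof.
rewrite -sqrtr_sqr /enorm ler_sqrt; last first.
  by rewrite /dotrV sumr_ge0// => j _; rewrite -expr2 sqr_ge0.
rewrite /dotrV (bigD1 i)//= -expr2 lerDl sumr_ge0// => j _.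
by rewrite -expr2 sqr_ge0.
Qed.

Lemma enorm_le_sum x : enorm x <= \sum_i `|x ord0 i|.
Proof.
have s0 : 0 <= \sum_i `|x ord0 i| by rewrite sumr_ge0.
rewrite -[leRHS]ger0_norm// -sqrtr_sqr ler_wsqrtr// expr2 mulr_suml ler_sum// => i _.
have -> : x ord0 i * x ord0 i = `|x ord0 i| * `|x ord0 i|.
  by rewrite -normrM ger0_norm// -expr2 sqr_ge0.
by rewrite ler_wpM2l// (bigD1 i)//= lerDl sumr_ge0.
Qed.

Lemma dotrV_ball_le (r : R) x y : eball r x -> eball r y ->
  `|dotrV x y| <= d%:R * r ^+ 2.
Proof.
move=> /= xr yr; apply: le_trans (ler_norm_sum _ _ _) _.
rewrite mulr_natl -[X in _ *+ X]card_ord -sumr_const ler_sum// => i _.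
rewrite normrM expr2 ler_pM// ltW// (le_lt_trans (coord_le_enorm _ i))//.
Qed.

End coordinates.

Section max_affine.
Context {R : realType} {d p : nat}.
Variable y : 'I_p.+1 -> 'rV[R]_d.
Implicit Types (x z q : 'rV[R]_d) (psi : 'I_p.+1 -> R).

Definition affine psi k x : R := dotrV x (y k) + psi k.

(** Starting the maximum from index 0 keeps it real-valued; this is why the
index set is taken of the form 'I_p.+1. *)
Definition max_affine psi x : R :=
  \big[Num.max/affine psi ord0 x]_(k < p.+1) affine psi k x.

Lemma affine_le_max psi k x : affine psi k x <= max_affine psi x.
Proof. exact: le_bigmax. Qed.

Lemma max_affine_le psi x c :
  (forall k, affine psi k x <= c) -> max_affine psi x <= c.
Proof. by move=> h; apply/bigmax_leP. Qed.

Lemma max_affine_attained psi x : exists k, max_affine psi x = affine psi k x.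
Proof.
rewrite /max_affine; elim/big_ind: _ => [|a b [k ->] [l ->]|k _].
- by exists ord0.
- by case: (leP (affine psi k x) (affine psi l x)) => _; [exists l|exists k].
- by exists k.
Qed.

Lemma max_affine_dist psi psi' (c : R) x :
  (forall k, `|psi k - psi' k| <= c) ->
  `|max_affine psi x - max_affine psi' x| <= c.
Proof.
move=> h; have [k kE] := max_affine_attained psi x.
have [l lE] := max_affine_attained psi' x.
have := affine_le_max psi l x; have := affine_le_max psi' k x.
have := h k; have := h l; rewrite kE lE /affine !ler_norml; lra.
Qed.

Lemma max_affine_shift psi (c : R) x :
  max_affine (fun k => psi k + c) x = max_affine psi x + c.
Proof.
have [k kE] := max_affine_attained psi x.
have [l lE] := max_affine_attained (fun k => psi k + c) x.
have := affine_le_max psi l x; have := affine_le_max (fun k => psi k + c) k x.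
rewrite kE lE /affine; lra.
Qed.

Lemma max_affine_convex psi x z (t : R) : 0 <= t <= 1 ->
  max_affine psi (t *: x + (1 - t) *: z) <=
  t * max_affine psi x + (1 - t) * max_affine psi z.
Proof.
move=> /andP[t0 t1]; apply: max_affine_le => k.
have := affine_le_max psi k x; have := affine_le_max psi k z.
rewrite /affine dotrVDl !dotrVZl; nra.
Qed.

(** Convexity along the line through x in direction u: increments over a step
of fixed length are nondecreasing. The two middle points are convex
combinations of the outer ones, with exchanged weights. *)
Lemma max_affine_increment psi x u (s t h : R) : s <= t -> 0 < h ->
  max_affine psi (x + (s + h) *: u) - max_affine psi (x + s *: u) <=
  max_affine psi (x + (t + h) *: u) - max_affine psi (x + t *: u).
Proof.
move=> st h0; pose l := h / (t - s + h).
have e0 : 0 < t - s + h by lra.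
have l01 : 0 <= l <= 1.
  apply/andP; split; first by rewrite divr_ge0// ltW.
  by rewrite ler_pdivrMr//; lra.
have l01' : 0 <= 1 - l <= 1 by move: l01; lra.
have lE : l * (t - s + h) = h by rewrite /l divfK// gt_eqF.
have := max_affine_convex psi (x + (t + h) *: u) (x + s *: u) l01.
have := max_affine_convex psi (x + (t + h) *: u) (x + s *: u) l01'.
have -> : l *: (x + (t + h) *: u) + (1 - l) *: (x + s *: u) =
    x + (s + h) *: u.
  rewrite !scalerDr !scalerA addrACA -!scalerDl -[RHS]/(_ + _).
  have -> : l + (1 - l) = 1 by lra.
  rewrite scale1r; congr (_ + _ *: _); lra.
have -> : (1 - l) *: (x + (t + h) *: u) + (1 - (1 - l)) *: (x + s *: u) =
    x + t *: u.
  rewrite !scalerDr !scalerA addrACA -!scalerDl.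
  have -> : 1 - l + (1 - (1 - l)) = 1 by lra.
  rewrite scale1r; congr (_ + _ *: _); lra.
lra.
Qed.

Lemma max_affine_lipschitz psi x i (c t : R) :
  (forall k, `|y k ord0 i| <= c) ->
  `|max_affine psi (x + t *: delta_mx ord0 i) - max_affine psi x| <= `|t| * c.
Proof.
move=> yc; have [k kE] := max_affine_attained psi x.
have [l lE] := max_affine_attained psi (x + t *: delta_mx ord0 i).
have := affine_le_max psi l x.
have := affine_le_max psi k (x + t *: delta_mx ord0 i).
rewrite kE lE /affine !dotrVDl !dotrVZl !dotrV_delta.
have hk : `|t * y k ord0 i| <= `|t| * c by rewrite normrM ler_wpM2l.
have hl : `|t * y l ord0 i| <= `|t| * c by rewrite normrM ler_wpM2l.
move: hk hl; rewrite !ler_norml; lra.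
Qed.

Definition second_diff psi (h : R) i x : R :=
  max_affine psi (x + h *: delta_mx ord0 i) +
  max_affine psi (x - h *: delta_mx ord0 i) - 2 * max_affine psi x.

Lemma second_diff_ge0 psi h i x : 0 < h -> 0 <= second_diff psi h i x.
Proof.
move=> h0; have hh : - h <= 0 by lra.
have := max_affine_increment psi x (delta_mx ord0 i) hh h0.
rewrite addNr scale0r addr0 add0r scaleNr /second_diff; lra.
Qed.

Definition subgradient psi x q := forall z,
  max_affine psi x + dotrV q (z - x) <= max_affine psi z.

Lemma active_subgradient psi x k :
  max_affine psi x = affine psi k x -> subgradient psi x (y k).
Proof.
move=> kE z; apply: le_trans (affine_le_max psi k z).
rewrite kE /affine [dotrV (y k) _]dotrVC dotrVDl dotrVNl; lra.
Qed.

(** The vector y_k is a subgradient at x up to the error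
max_affine psi x - affine psi k x. Testing both the exact and the approximate
subgradient inequality at x + h e_i and x - h e_i squeezes the difference of
the i-th coordinates. *)
Lemma subgradient_dist psi x q k (h : R) i : 0 < h -> subgradient psi x q ->
  `|q ord0 i - y k ord0 i| <=
  (max_affine psi x - affine psi k x + second_diff psi h i x) / h.
Proof.
move=> h0 sq; rewrite ler_pdivlMr//.
have E t : dotrV q (x + t *: delta_mx ord0 i - x) = t * q ord0 i.
  by rewrite addrAC subrr add0r dotrVC dotrVZl dotrV_delta.
have := sq (x + h *: delta_mx ord0 i).
have := sq (x + (- h) *: delta_mx ord0 i); rewrite !E.
have := affine_le_max psi k (x + h *: delta_mx ord0 i).
have := affine_le_max psi k (x + (- h) *: delta_mx ord0 i).
rewrite /second_diff /affine -scaleNr !dotrVDl !dotrVZl !dotrV_delta => a1 a2 a3 a4.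
have -> : `|q ord0 i - y k ord0 i| * h = `|(q ord0 i - y k ord0 i) * h|.
  by rewrite normrM (gtr0_norm h0).
by rewrite ler_norml; apply/andP; split; lra.
Qed.

Definition midpoint psi psi' : 'I_p.+1 -> R := fun k => (psi k + psi' k) / 2.

Definition jensen_gap psi psi' x : R :=
  max_affine psi x + max_affine psi' x - 2 * max_affine (midpoint psi psi') x.

Lemma jensen_gap_ge0 psi psi' x : 0 <= jensen_gap psi psi' x.
Proof.
have [k kE] := max_affine_attained (midpoint psi psi') x.
rewrite /jensen_gap kE.
have := affine_le_max psi k x; have := affine_le_max psi' k x.
rewrite /affine /midpoint; lra.
Qed.

(** An index active at x for the midpoint weights gives a common approximate
subgradient, whose two errors add up to the Jensen gap. *)
Lemma subgradient_compare psi psi' x q q' (h : R) i : 0 < h ->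
  subgradient psi x q -> subgradient psi' x q' ->
  `|q ord0 i - q' ord0 i| <=
  (jensen_gap psi psi' x + second_diff psi h i x + second_diff psi' h i x) / h.
Proof.
move=> h0 sq sq'; have [k kE] := max_affine_attained (midpoint psi psi') x.
have := subgradient_dist k i h0 sq; have := subgradient_dist k i h0 sq'.
rewrite !ler_pdivlMr// => b' b.
have tri : `|q ord0 i - q' ord0 i| <=
    `|q ord0 i - y k ord0 i| + `|q' ord0 i - y k ord0 i|.
  by rewrite [X in _ <= _ + X]distrC (ler_distD (y k ord0 i)).
apply: le_trans (ler_wpM2r (ltW h0) tri) _.
move: b b'; rewrite /jensen_gap kE /affine /midpoint mulrDl; lra.
Qed.

End max_affine.

(** * Semicontinuity and measurability on row vectors *)

Section borel_rV.
Context {R : realType} {d : nat}.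

(** The sigma-algebra of row vectors is generated by the coordinates; it
contains the open sets because each of them is a countable union of boxes with
rational centres and sizes 1/k. *)
Lemma open_measurable_rV (U : set 'rV[R]_d) : open U -> measurable U.
Proof.
move=> oU; pose box (q : 'rV[rat]_d * nat) : set 'rV[R]_d :=
  [set x | forall i, `|x ord0 i - ratr (q.1 ord0 i)| < q.2.+1%:R^-1].
have mbox q : measurable (box q).
  have -> : box q = \bigcap_(i in [set: 'I_d])
      (fun x : 'rV[R]_d => x ord0 i) @^-1`
        [set t | `|t - ratr (q.1 ord0 i)| < q.2.+1%:R^-1].
    by apply/seteqP; split => x /= h i; [move=> _|]; exact: h.
  apply: fin_bigcap_measurable => // i _.
  rewrite -[X in measurable X]setTI; apply: measurable_fun_coord => //.
  have -> : [set t : R | `|t - ratr (q.1 ord0 i)| < q.2.+1%:R^-1] =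
      `](ratr (q.1 ord0 i) - q.2.+1%:R^-1), (ratr (q.1 ord0 i) + q.2.+1%:R^-1)[%classic.
    by apply/seteqP; split => t; rewrite /= in_itv /= ltr_distl.
  exact: measurable_itv.
pose F q := [set x | box q x /\ box q `<=` U].
have -> : U = \bigcup_q F q.
  apply/seteqP; split => x; last by move=> [q _ [xq]]; exact.
  move=> Ux; have /nbhs_ballP[e /= e0 eU] : nbhs x U by exact: open_nbhs_nbhs.
  have e20 : 0 < e / 2 by rewrite divr_gt0.
  have [k _ /(_ k (leqnn k)) /= ke] := near_infty_natSinv_lt (PosNum e20).
  have k0 : 0 < k.+1%:R^-1 :> R by rewrite invr_gt0.
  have qP i : exists q : rat, `|x ord0 i - ratr q| < k.+1%:R^-1.
    have /rat_in_itvoo[q] : x ord0 i - k.+1%:R^-1 < x ord0 i + k.+1%:R^-1.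
      by rewrite ltrD2l (lt_trans _ k0)// oppr_lt0.
    by rewrite in_itv /= => h; exists q; rewrite ltr_distlC.
  have [q qE] := choice qP.
  exists (\row_i q i, k) => //; split=> [i|z zq].
    by rewrite /= mxE.
  apply: eU; split => // i j; rewrite ord1 /ball /=.
  have := zq j; have := qE j; rewrite /= mxE.
  move=> xq; rewrite distrC => qz.
  apply: le_lt_trans (ler_distD (ratr (q j)) _ _) _.
  by rewrite [e]splitr ltrD// (lt_trans _ ke).
apply: countable_bigcupT_measurable => [|q]; first exact: countableP.
have [qU|qU] := pselect (box q `<=` U).
  by rewrite (_ : F q = box q)//; apply/seteqP; split=> // x [].
by rewrite (_ : F q = set0)//; apply/seteqP; split=> // x [].
Qed.

Lemma lower_semicontinuous_measurable_rV (f : 'rV[R]_d -> \bar R) :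
  lower_semicontinuous f -> measurable_fun setT f.
Proof.
move=> lf; apply: (measurability _ (ErealGenOInfty.measurableE R)).
move=> /= _ [_ [a ->]] <-; apply: measurableI => //.
apply: open_measurable_rV.
by rewrite preimage_itvoy; move/lower_semicontinuousP : lf; exact.
Qed.

Lemma continuous_dotrV (y : 'rV[R]_d) : continuous (fun x => dotrV x y).
Proof.
apply: (@continuous_big _ _ +%R 0 xpredT (@add_continuous _)) => i _ x.
by apply: continuousM; [exact: coord_continuous|exact: cst_continuous].
Qed.

Lemma measurable_dotrV (y : 'rV[R]_d) : measurable_fun setT (fun x => dotrV x y).
Proof.
apply: measurable_sum => i; apply: measurable_funM => //.
exact: measurable_fun_coord.
Qed.

(** A supremum of functions that are continuous or constantly infinite. *)
Lemma conjugate_lsc (phi : 'rV[R]_d -> \bar R) :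
  lower_semicontinuous (conjugate phi).
Proof.
move=> z a; rewrite /conjugate => /ereal_sup_gt[_ [x _ <-]] ha.
suff [V zV hV] : exists2 V, nbhs z V &
    forall w, V w -> (a%:E < (dotrV x w)%:E - phi x)%E.
  exists V => // w /hV h; apply: lt_le_trans h _.
  by apply: ereal_sup_ubound; exists x.
move: ha; case: (phi x) => [c| |] ha //; last by exists setT => //; exact: filterT.
exists [set w | a + c < dotrV x w]; last first.
  by move=> w /=; rewrite -EFinB lte_fin; lra.
have czx : {for z, continuous (dotrV x)}.
  rewrite (_ : dotrV x = fun w => dotrV w x); first exact: continuous_dotrV.
  by apply/funext => w; rewrite dotrVC.
apply: (czx [set t | a + c < t]).
apply: open_nbhs_nbhs; split; first exact: open_gt.
by move: ha; rewrite /= -EFinB lte_fin; lra.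
Qed.

Lemma lsc_cube_lower_bound (f : 'rV[R]_d -> \bar R) (r : R) :
  (forall x, f x != -oo%E) -> lower_semicontinuous f ->
  exists c : R, forall x : 'rV[R]_d, (forall i, `|x ord0 i| <= r) -> (c%:E <= f x)%E.
Proof.
move=> fNy lf; pose K := [set x : 'rV[R]_d | forall i, `[- r, r]%classic (x ord0 i)].
have cK : compact K.
  apply: (@rV_compact _ _ (fun=> `[- r, r]%classic)) => i.
  exact: segment_compact.
move: cK; rewrite compact_cover => /(_ nat setT (fun k => [set x | ((- k%:R)%:E < f x)%E])).
case.
- by move=> k _; move/lower_semicontinuousP : lf; exact.
- move=> x _; have := fNy x; case fxE : (f x) => [t| |] // _.
    have [k _ /(_ k (leqnn k)) /= tk] := nbhs_infty_gtr (- t).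
    by exists k => //=; rewrite fxE lte_fin ltrNl.
  by exists 0%N => //=; rewrite fxE ltry.
- move=> D _ KD; exists (- (\max_(k <- finmap.enum_fset D) k)%:R) => x xr.
  have [|k /= kD fk] := KD x; first by move=> i /=; rewrite in_itv /= -ler_norml.
  by rewrite (le_trans _ (ltW fk))// lee_fin lerN2 ler_nat leq_bigmax_seq.
Qed.

End borel_rV.

(** * Integrals over a cube computed along coordinate lines *)

Section slicing.
Context {R : realType}.
Local Notation leb := (@lebesgue_measure R).
Local Open Scope ereal_scope.

Definition set_coord n (i : 'I_n) (t : R) (x : 'rV[R]_n) : 'rV[R]_n :=
  \row_j (if j == i then t else x ord0 j).

Definition cube n (r : R) : set 'rV[R]_n :=
  [set x | forall i, `[(- r)%R, r]%classic (x ord0 i)].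

Lemma cube_measurable n r : measurable (@cube n r).
Proof.
have -> : @cube n r = \bigcap_(i in [set: 'I_n])
    (fun x : 'rV[R]_n => x ord0 i) @^-1` `[(- r)%R, r]%classic.
  by apply/seteqP; split => x /= h i; [move=> _|]; exact: h.
apply: fin_bigcap_measurable => // i _.
by rewrite -[X in measurable X]setTI; exact: measurable_fun_coord.
Qed.

Lemma rV_cons0 n (t : R) (v : 'rV[R]_n) : rV_cons (t, v) ord0 ord0 = t.
Proof. by rewrite mxE unlift_none. Qed.

Lemma rV_consS n (t : R) (v : 'rV[R]_n) j :
  rV_cons (t, v) ord0 (lift ord0 j) = v ord0 j.
Proof. by rewrite mxE liftK. Qed.

Lemma rV_cons_cube n r (t : R) (v : 'rV[R]_n) :
  cube r (rV_cons (t, v)) <-> `[(- r)%R, r]%classic t /\ cube r v.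
Proof.
split=> [h|[ht hv] i].
  split=> [|j]; first by have := h ord0; rewrite rV_cons0.
  by have := h (lift ord0 j); rewrite rV_consS.
case: (unliftP ord0 i) => [j|] ->; first by rewrite rV_consS; exact: hv.
by rewrite rV_cons0.
Qed.

Lemma set_coord_rV_cons0 n (s t : R) (v : 'rV[R]_n) :
  set_coord ord0 s (rV_cons (t, v)) = rV_cons (s, v).
Proof.
apply/rowP => k; rewrite mxE; case: (unliftP ord0 k) => [j|] ->.
  by rewrite !rV_consS.
by rewrite eqxx rV_cons0.
Qed.

Lemma set_coord_rV_consS n (j : 'I_n) (s t : R) (v : 'rV[R]_n) :
  set_coord (lift ord0 j) s (rV_cons (t, v)) = rV_cons (t, set_coord j s v).
Proof.
apply/rowP => k; rewrite mxE; case: (unliftP ord0 k) => [l|] ->.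
  by rewrite !rV_consS mxE (inj_eq lift_inj).
by rewrite !rV_cons0.
Qed.

Lemma interval_measure (r : R) : (0 <= r)%R ->
  leb `[(- r)%R, r]%classic = (2 * r)%:E.
Proof.
move=> r0; rewrite lebesgue_measure_itv /= lte_fin -EFinB.
case: ltrP => h; congr (_%:E); lra.
Qed.

Lemma cube_measure n (r : R) : (0 <= r)%R ->
  lebesgue_rV n (cube r) = ((2 * r) ^+ n)%:E.
Proof.
move=> r0; elim: n => [|n IHn].
  by rewrite /= diracE mem_set ?expr0// => -[].
rewrite /= /lebesgue_rV_step /pushforward.
have -> : @rV_cons R n @^-1` cube r = `[(- r)%R, r]%classic `*` cube r.
  by apply/seteqP; split => -[t v] /rV_cons_cube.
rewrite product_measure1E//; last exact: cube_measurable.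
by rewrite [X in X * _]interval_measure// IHn -EFinM exprS.
Qed.

Lemma integral_rV_cons n (F : 'rV[R]_n.+1 -> \bar R) :
  measurable_fun setT F -> (forall x, 0 <= F x) ->
  \int[lebesgue_rV n.+1]_x F x =
  \int[leb \x lebesgue_rV n]_p F (rV_cons p).
Proof.
move=> mF F0; exact: (@ge0_integral_pushforward _ _ _ _ _ _
  (@measurable_rV_cons R n) (leb \x lebesgue_rV n) setT F).
Qed.

(** Fubini, by induction on the dimension: the iterated Lebesgue measure adds
the first coordinate last, so that one either integrates first along that
coordinate, or freezes it and uses the induction hypothesis. *)
Lemma slice_integral_le n (i : 'I_n) (F : 'rV[R]_n -> \bar R) (r K : R) :
  (0 <= r)%R -> (0 <= K)%R -> measurable_fun setT F -> (forall x, 0 <= F x) ->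
  (forall x, ~ cube r x -> F x = 0) ->
  (forall x, \int[leb]_t F (set_coord i t x) <= K%:E) ->
  \int[lebesgue_rV n]_x F x <= (K * (2 * r) ^+ n.-1)%:E.
Proof.
move=> r0 K0; elim: n i F => [[]//|n IHn] i F mF F0 Fcube Fslice.
have mFc : measurable_fun setT (F \o @rV_cons R n).
  by apply: measurableT_comp => //; exact: measurable_rV_cons.
rewrite integral_rV_cons//.
move: i Fslice => i; case: (unliftP ord0 i) => [j|] -> Fslice.
- rewrite (fubini_tonelli1 (F \o @rV_cons R n))//; last by move=> ?; exact: F0.
  have n0 : (0 < n)%N by exact: leq_ltn_trans (leq0n _) (ltn_ord j).
  have E : \int[leb]_t ((K * (2 * r) ^+ n.-1)%:E * (\1_(`[(- r)%R, r]%classic) t)%:E) =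
      (K * (2 * r) ^+ n)%:E.
    rewrite ge0_integralZl//.
    + rewrite integral_indic// setIT [X in _ * X]interval_measure// -EFinM.
      by rewrite -mulrA -exprSr prednK.
    + by apply/measurable_EFinP; exact: measurable_indic.
    + by rewrite lee_fin mulr_ge0// exprn_ge0// mulr_ge0.
  rewrite -E; apply: ge0_le_integral => //.
  + by move=> t _; apply: integral_ge0 => ? _; exact: F0.
  + by apply: (measurable_fun_fubini_tonelli_F (F \o @rV_cons R n)) => // ?; exact: F0.
  + apply: emeasurable_funM => //; apply/measurable_EFinP; exact: measurable_indic.
  move=> t _; rewrite /fubini_F indicE.
  have [/set_mem tr|/negP tr] := boolP (t \in _).
    rewrite mule1; apply: (IHn j) => //=.
    - exact: (measurableT_comp mFc (pair1_measurable t)).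
    - by move=> v nv; apply: Fcube; rewrite rV_cons_cube => -[].
    - by move=> v; under eq_integral do rewrite -set_coord_rV_consS; exact: Fslice.
  rewrite mule0 integral0_eq// => v _; apply: Fcube; rewrite rV_cons_cube => -[tr' _].
  by apply: tr; exact: mem_set.
- rewrite (fubini_tonelli2 (F \o @rV_cons R n))//; last by move=> ?; exact: F0.
  have E : \int[lebesgue_rV n]_v (K%:E * (\1_(cube r) v)%:E) =
      (K * (2 * r) ^+ n)%:E.
    rewrite ge0_integralZl//.
    + rewrite integral_indic//; last exact: cube_measurable.
      by rewrite setIT EFinM; congr (_ * _); exact: cube_measure.
    + by apply/measurable_EFinP; apply: measurable_indic; exact: cube_measurable.
  rewrite -E; apply: ge0_le_integral => //.
  + by move=> t _; apply: integral_ge0 => ? _; exact: F0.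
  + by apply: (measurable_fun_fubini_tonelli_G (F \o @rV_cons R n)) => // ?; exact: F0.
  + apply: emeasurable_funM => //; apply/measurable_EFinP.
    by apply: measurable_indic; exact: cube_measurable.
  move=> v _; rewrite /fubini_G indicE.
  have [/set_mem vr|/negP vr] := boolP (v \in _).
    rewrite mule1 (le_trans _ (Fslice (rV_cons (0%R, v))))//.
    by under [leRHS]eq_integral do rewrite set_coord_rV_cons0.
  rewrite mule0 integral0_eq// => t _; apply: Fcube; rewrite rV_cons_cube => -[_ vr'].
  by apply: vr; exact: mem_set.
Qed.

End slicing.

(** * Lower integrals and shifts of monotone functions *)

Section lower_integral.
Local Open Scope ereal_scope.
Context d (T : measurableType d) (R : realType).
Variable mu : {measure set T -> \bar R}.

(** The integral of a nonnegative function is a supremum over the simple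
functions below it, hence is monotone without any measurability. This is what
allows arbitrary selections of subgradients. *)
Lemma ge0_le_integralT (f g : T -> \bar R) :
  (forall x, 0 <= f x) -> (forall x, f x <= g x) ->
  \int[mu]_x f x <= \int[mu]_x g x.
Proof.
move=> f0 fg; rewrite !ge0_integralTE//; last first.
  by move=> x; exact: le_trans (f0 x) (fg x).
apply: le_ereal_sup => _ [h hf <-]; exists h => // x.
exact: le_trans (hf x) (fg x).
Qed.

Lemma ae_le_integralT (f g : T -> \bar R) (N : set T) :
  measurable N -> mu N = 0 -> measurable_fun setT g ->
  (forall x, 0 <= f x) -> (forall x, 0 <= g x) ->
  (forall x, ~ N x -> f x <= g x) ->
  \int[mu]_x f x <= \int[mu]_x g x.
Proof.
move=> mN N0 mg f0 g0 fg.
(* Raising g to +oo on N makes the bound hold everywhere. *)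
pose k x := g x + (cst +oo \_ N) x.
have mk : measurable_fun setT k.
  apply: emeasurable_funD => //.
  by apply/(measurable_restrictT _ mN); exact: measurable_cst.
have k0 x : 0 <= k x by rewrite /k patchE; case: ifP => _; rewrite /= adde_ge0 ?leey.
apply: (@le_trans _ _ (\int[mu]_x k x)).
  apply: ge0_le_integralT => // x; rewrite /k patchE; case: ifPn => [_|/negP xN].
    by rewrite addey ?leey// gt_eqF// (lt_le_trans _ (g0 x)).
  by rewrite adde0 fg// => Nx; apply: xN; exact: mem_set.
rewrite (@ge0_ae_eq_integral _ _ _ mu setT k g)//.
exists N; split => // x /= /not_implyP[_]; apply: contra_notP => Nx.
by rewrite /k patchE memNset// adde0.
Qed.

End lower_integral.

Section monotone_shift.
Context {R : realType}.
Local Notation leb := (@lebesgue_measure R).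
Variables (f : R -> R) (h : R).
Hypothesis h0 : 0 < h.
Hypothesis f_nd : {homo f : s t / s <= t}.
Hypothesis mf : measurable_fun setT (fun t => f t - f (t - h)).

Let shift_ge0 t : (0 <= (f t - f (t - h))%:E)%E.
Proof. by rewrite lee_fin subr_ge0 f_nd// gerBl ltW. Qed.

Let mfE : measurable_fun setT (fun t => (f t - f (t - h))%:E).
Proof. exact/measurable_EFinP. Qed.

(** On a cell of length h starting at b, the integrand f t - f (t - h) is at
most f (b + h) - f (b - h), and these bounds telescope from one cell to the
next. *)
Lemma integral_monotone_steps (a : R) (n : nat) :
  (\int[leb]_(t in `[a, (a + n%:R * h)%R[) (f t - f (t - h))%:E <=
  (h * (f (a + n%:R * h) + f (a + n%:R * h - h) - f a - f (a - h)))%:E)%E.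
Proof.
elim: n => [|n IHn].
  rewrite mul0r addr0 set_itvco0 integral_set0 lee_fin.
  rewrite (_ : _ - f (a - h) = 0) ?mulr0//; lra.
pose b := a + n%:R * h.
have bE : a + n.+1%:R * h = b + h by rewrite /b -natr1 mulrDl mul1r addrA.
rewrite bE addrK.
have -> : `[a, b + h[%classic = `[a, b[%classic `|` `[b, (b + h)[%classic.
  rewrite -itv_bndbnd_setU//= bnd_simp lerDl; last exact: ltW.
  by rewrite mulr_ge0// ltW.
rewrite ge0_integral_setU//; first last.
- apply/disj_setPS => t [] /=; rewrite !in_itv/= => /andP[_ tb] /andP[bt _].
  by move: (lt_le_trans tb bt); rewrite ltxx.
- exact: measurable_funTS.
have step : (\int[leb]_(t in `[b, (b + h)%R[) (f t - f (t - h))%:E <=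
    (h * (f (b + h) - f (b - h)))%:E)%E.
  apply: (@le_trans _ _ (\int[leb]_(t in `[b, (b + h)%R[) (cst (f (b + h) - f (b - h))%:E t))%E).
    apply: ge0_le_integral => //; first exact: measurable_funTS.
    move=> t /=; rewrite in_itv/= => /andP[bt tb]; rewrite lee_fin.
    have := f_nd (ltW tb); have : f (b - h) <= f (t - h) by apply: f_nd; lra.
    lra.
  rewrite integral_cst// [X in (_ * X)%E]lebesgue_measure_itv /= lte_fin ltrDl h0 -EFinB.
  by rewrite -EFinM lee_fin [b + h]addrC addrK mulrC.
apply: le_trans (leeD IHn step) _.
rewrite -EFinD lee_fin -/b; lra.
Qed.

Lemma integral_monotone_shift (L r : R) : 0 <= r -> (forall t, `|f t| <= L) ->
  (\int[leb]_(t in `[(- r)%R, r]) (f t - f (t - h))%:E <= (4 * h * L)%:E)%E.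
Proof.
move=> r0 fL; pose n := (Num.truncn (2 * r / h)).+1.
have rn : r < - r + n%:R * h.
  have : 2 * r / h < n%:R.
    by rewrite /n; have /andP[_] := truncn_itv (divr_ge0 (mulr_ge0 (ler0n R 2) r0) (ltW h0)).
  by rewrite ltr_pdivrMr//; lra.
apply: le_trans (le_trans (integral_monotone_steps (- r) n) _).
  apply: ge0_subset_integral => //; first exact: measurable_funTS.
  move=> t /=; rewrite !in_itv/= => /andP[-> tr]; exact: le_lt_trans tr rn.
rewrite lee_fin.
have := fL (- r + n%:R * h); have := fL (- r + n%:R * h - h).
have := fL (- r); have := fL (- r - h); rewrite !ler_norml => H1 H2 H3 H4.
have : f (- r + n%:R * h) + f (- r + n%:R * h - h) - f (- r) - f (- r - h) <= 4 * L.
  lra.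
by move/(ler_wpM2l (ltW h0)); lra.
Qed.

End monotone_shift.

(** * Measures with bounded density *)

Section measurable_max_affine.
Context {R : realType} {d p : nat}.
Variable y : 'I_p.+1 -> 'rV[R]_d.
Implicit Types (psi : 'I_p.+1 -> R).

Lemma measurable_max_affine psi : measurable_fun setT (max_affine y psi).
Proof.
have maff k : measurable_fun setT (affine y psi k).
  by apply: measurable_funD => //; exact: measurable_dotrV.
rewrite /max_affine; elim: (index_enum _) => [|k s IHs].
  by under eq_fun do rewrite big_nil; exact: maff.
under eq_fun do rewrite big_cons.
exact: measurable_maxr.
Qed.

Lemma measurable_translate (v : 'rV[R]_d) :
  measurable_fun setT (fun x : 'rV[R]_d => x + v).
Proof.
apply: measurable_fun_rV => i; under eq_fun do rewrite mxE.
by apply: measurable_funD => //; exact: measurable_fun_coord.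
Qed.

Lemma measurable_second_diff psi h i : measurable_fun setT (second_diff y psi h i).
Proof.
apply: measurable_funB; last first.
  by apply: measurable_funM => //; exact: measurable_max_affine.
by apply: measurable_funD; apply: (measurableT_comp (measurable_max_affine psi));
  exact: measurable_translate.
Qed.

Lemma measurable_jensen_gap psi psi' :
  measurable_fun setT (jensen_gap y psi psi').
Proof.
apply: measurable_funB; first by apply: measurable_funD; exact: measurable_max_affine.
by apply: measurable_funM => //; exact: measurable_max_affine.
Qed.

End measurable_max_affine.

Section bounded_density.
Context {R : realType} {d : nat}.
Local Notation leb := (@lebesgue_measure R).
Variables (mu : {measure set 'rV[R]_d -> \bar R}) (M r : R).
Hypothesis M0 : 0 <= M.
Hypothesis r0 : 0 <= r.
Hypothesis mu_le : forall A, measurable A -> (mu A <= M%:E * lebesgue_rV d A)%E.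
Hypothesis mu_cube : mu (~` cube r) = 0%E.

Lemma set_coordE i t (x : 'rV[R]_d) :
  set_coord i t x = set_coord i 0 x + t *: delta_mx ord0 i.
Proof.
apply/rowP => j; rewrite !mxE eqxx /=; case: eqP => _; last by rewrite mulr0 addr0.
by rewrite mulr1 add0r.
Qed.

Lemma measurable_set_coord i (x : 'rV[R]_d) :
  measurable_fun setT (fun t => set_coord i t x).
Proof.
apply: measurable_fun_rV => j; under eq_fun do rewrite mxE.
by case: eqP => _; [exact: measurable_id|exact: measurable_cst].
Qed.

Lemma density_slice_le i (F : 'rV[R]_d -> \bar R) (K : R) : 0 <= K ->
  measurable_fun setT F -> (forall x, 0 <= F x)%E ->
  (forall x, \int[leb]_(t in `[(- r)%R, r]) F (set_coord i t x) <= K%:E)%E ->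
  (\int[mu]_x F x <= (M * (K * (2 * r) ^+ d.-1))%:E)%E.
Proof.
move=> K0 mF F0 Fs; pose G := F \_ (cube r).
have mcube := cube_measurable (R := R) (n := d) r.
have mG : measurable_fun setT G.
  by apply/(measurable_restrictT _ mcube); exact: measurable_funTS.
have G0 x : (0 <= G x)%E by apply: erestrict_ge0 => ? _; exact: F0.
apply: (@le_trans _ _ (\int[mu]_x G x)%E).
  apply: (@ae_le_integralT _ _ _ mu _ _ (~` cube r)) => //.
    exact: measurableC.
  by move=> x /contrapT xc; rewrite /G patchE mem_set.
apply: (@le_trans _ _ (\int[mscale (NngNum M0) (lebesgue_rV d)]_x G x)%E).
  by apply: ge0_le_measure_integral.
rewrite ge0_integral_mscale// EFinM lee_wpmul2l ?lee_fin//.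
apply: (slice_integral_le (i := i)) => //.
  by move=> x xc; rewrite /G patchE memNset.
move=> x; apply: le_trans (Fs x); rewrite [leRHS]integral_mkcond.
apply: ge0_le_integralT => // t.
rewrite /G !patchE; case: ifPn => [/set_mem /(_ i)|_].
  by rewrite mxE eqxx => tr; rewrite mem_set.
by case: ifP.
Qed.

Lemma slice_countable_null i (B : set 'rV[R]_d) : measurable B ->
  (forall x, countable [set t | B (set_coord i t x)]) -> mu B = 0%E.
Proof.
move=> mB cB; suff : (\int[mu]_x (\1_B x)%:E <= 0)%E.
  by rewrite integral_indic// setIT measure_le0 => /eqP.
have mS x : measurable [set t | B (set_coord i t x)].
  rewrite -[X in measurable X]setTI.
  exact: (measurable_set_coord i x measurableT mB).
have -> : 0%E = (M * (0 * (2 * r) ^+ d.-1))%:E by rewrite mul0r mulr0.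
apply: (@density_slice_le i) => //.
- by apply/measurable_EFinP; exact: measurable_indic.
- move=> x; have -> : (\int[leb]_(t in `[(- r)%R, r]) (\1_B (set_coord i t x))%:E =
      \int[leb]_(t in `[(- r)%R, r]) (\1_[set t | B (set_coord i t x)] t)%:E)%E.
    by apply: eq_integral => t _; rewrite !indicE.
  rewrite integral_indic//; last exact: mS.
  rewrite [leLHS](@countable_lebesgue_measure0 R)//.
  by apply: sub_countable (cB x); apply: subset_card_le; exact: subIsetl.
Qed.

(** Along a line in direction i, the second difference is f t - f (t - h) for
the increment f of the potential over a step h, which is nondecreasing by
convexity and bounded by h c by the Lipschitz estimate. *)
Lemma integral_second_diff_le p (y : 'I_p.+1 -> 'rV[R]_d) psi i (h c : R) :
  0 < h -> (forall k, `|y k ord0 i| <= c) ->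
  (\int[mu]_x (second_diff y psi h i x)%:E <=
   (M * (4 * h * (h * c) * (2 * r) ^+ d.-1))%:E)%E.
Proof.
move=> h0 yc; have c0 : 0 <= c by apply: le_trans (yc ord0).
apply: (@density_slice_le i).
- by rewrite !mulr_ge0// ltW.
- by apply/measurable_EFinP; exact: measurable_second_diff.
- by move=> x; rewrite lee_fin second_diff_ge0.
move=> x; set x0 := set_coord i 0 x.
pose g (t : R) := max_affine y psi (x0 + t *: delta_mx ord0 i).
pose f (t : R) := g (t + h) - g t.
have mg : measurable_fun setT g.
  apply: (measurableT_comp (measurable_max_affine y psi)).
  under eq_fun do rewrite -set_coordE.
  exact: measurable_set_coord.
have mf : measurable_fun setT f.
  apply: measurable_funB => //; apply: (measurableT_comp mg).
  exact: measurable_funD.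
have E t : second_diff y psi h i (set_coord i t x) = f t - f (t - h).
  rewrite /second_diff /f /g set_coordE -/x0 subrK -!addrA -scalerDl -scalerBl.
  lra.
under eq_integral do rewrite E.
apply: integral_monotone_shift => //.
- by move=> s t st; rewrite /f /g max_affine_increment.
- apply: measurable_funB => //; apply: (measurableT_comp mf).
  exact: measurable_funB.
move=> t; rewrite /f /g scalerDl addrA.
by apply: le_trans (max_affine_lipschitz _ _ _ yc) _; rewrite gtr0_norm.
Qed.

End bounded_density.

(** * Products of functions of independent samples *)

Section bounded_integrable.
Context dT (T : measurableType dT) (R : realType) (mu : probability T R).

Lemma ae_bounded_integrable (A : set T) (f : T -> R) (B : R) : measurable A ->
  mu (~` A) = 0%E -> measurable_fun setT f -> (forall x, A x -> `|f x| <= B) ->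
  mu.-integrable setT (EFin \o f).
Proof.
move=> mA A0 mf fB; apply/integrableP; split; first exact/measurable_EFinP.
apply: (@le_lt_trans _ _ (\int[mu]_x (cst `|B|%:E x))%E).
  apply: (@ae_le_integralT _ _ _ mu _ _ (~` A)) => //.
  - exact: measurableC.
  - by move=> x; rewrite lee_fin.
  - by move=> x /contrapT Ax /=; rewrite lee_fin (le_trans (fB _ Ax))// ler_norm.
by rewrite integral_cst// [X in (_ * X)%E]probability_setT mule1 ltry.
Qed.

Lemma bounded_integrable (f : T -> R) (B : R) :
  measurable_fun setT f -> (forall x, `|f x| <= B) ->
  mu.-integrable setT (EFin \o f).
Proof.
move=> mf fB; apply: (@ae_bounded_integrable setT _ B) => //.
by rewrite setCT measure0.
Qed.

Lemma Rintegral_probability_cst (c : R) : \int[mu]_x c = c.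
Proof. by rewrite Rintegral_cst// [X in fine X]probability_setT mulr1. Qed.

End bounded_integrable.

Section iid_moments.
Context {dO dT : measure_display} {Omega : measurableType dO}.
Context {T : measurableType dT} {R : realType}.
Variables (P : probability Omega R) (mu : probability T R).
Variables (n : nat) (X : 'I_n -> {RV P >-> T}).
Hypothesis iidX : iid_sample mu X.

Lemma iid_preimage (A : 'I_n -> set T) : (forall i, measurable (A i)) ->
  P (\bigcap_i (X i @^-1` A i)) = (\prod_i fine (mu (A i)))%:E.
Proof.
move=> mA; have [ind law] := iidX.
have := ind [set: 'I_n]%SET A mA.
rewrite (_ : \bigcap_(i in _) _ = \bigcap_i (X i @^-1` A i)); last first.
  by apply/seteqP; split=> w h i _; apply: h => //=; rewrite inE.
move=> ->; rewrite -prodEFin; apply: eq_big => [i|i _]; first by rewrite inE.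
by rewrite -(law i _ (mA i)) fineK// fin_num_measure//; exact: mA.
Qed.

(** For simple functions, expanding the product of sums reduces the claim to
the product rule for events. *)
Lemma iid_simple_expectation N (A : 'I_N -> set T) (c : 'I_N -> R) :
  (forall l, measurable (A l)) -> (forall l, 0 <= c l) ->
  (\int[P]_w (\prod_i \sum_l c l * \1_(A l) (X i w))%:E =
   ((\sum_l c l * fine (mu (A l))) ^+ n)%:E)%E.
Proof.
move=> mA c0.
have mX i l : measurable (X i @^-1` A l).
  by rewrite -[X in measurable X]setTI; exact: measurable_funP.
have -> : (fun w => (\prod_i \sum_l c l * \1_(A l) (X i w))%:E) =
    (fun w => \sum_(z : {ffun 'I_n -> 'I_N})
      ((\prod_i c (z i)) * \1_(\bigcap_i (X i @^-1` A (z i))) w)%:E)%E.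
  apply/funext => w; rewrite sumEFin bigA_distr_bigA; congr _%:E.
  apply: eq_bigr => z _; rewrite big_split /=; congr (_ * _).
  have [wz|wz] := pselect (forall i, A (z i) (X i w)).
    rewrite indicE mem_set; last by move=> i _; exact: wz.
    by rewrite big1// => i _; rewrite indicE mem_set//; exact: wz.
  rewrite indicE memNset; last by move=> h; apply: wz => i; exact: h.
  have /existsNP[i wi] := wz.
  by rewrite (bigD1 i)//= indicE memNset// mul0r.
have mI (z : {ffun 'I_n -> 'I_N}) : measurable (\bigcap_i (X i @^-1` A (z i))).
  by apply: fin_bigcap_measurable => // i _; exact: mX.
rewrite ge0_integral_sum//; first last.
- by move=> z w _; rewrite lee_fin mulr_ge0// prodr_ge0.
- by move=> z; apply/measurable_EFinP; apply: measurable_funM => //; exact: measurable_indic.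
transitivity (\sum_(z : {ffun 'I_n -> 'I_N})
    (\prod_i (c (z i) * fine (mu (A (z i)))))%:E)%E.
  apply: eq_bigr => z _; under eq_integral do rewrite EFinM.
  rewrite ge0_integralZl//; first last.
  - by rewrite lee_fin prodr_ge0.
  - by apply/measurable_EFinP; exact: measurable_indic.
  rewrite integral_indic// setIT.
  by rewrite [X in (_ * X)%E](@iid_preimage (fun i => A (z i)))// -EFinM big_split.
rewrite sumEFin -(bigA_distr_bigA (fun _ l => c l * fine (mu (A l)))).
by rewrite prodr_const card_ord.
Qed.

(** Rounding f up to the next multiple of delta makes it simple. The additive
loss delta is kept, to be absorbed in the quadratic term of the exponential
moments. *)
Lemma iid_product_le (f : T -> R) (B delta : R) : 0 < delta ->
  measurable_fun setT f -> (forall x, 0 <= f x <= B) ->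
  (\int[P]_w (\prod_i f (X i w))%:E <= ((\int[mu]_x f x + delta) ^+ n)%:E)%E.
Proof.
move=> delta0 mf fB; pose N := (Num.truncn (B / delta)).+1.
pose A (l : 'I_N) := f @^-1` `[(l%:R * delta), (l.+1%:R * delta)[%classic.
pose c (l : 'I_N) := l.+1%:R * delta.
pose g x := \sum_l c l * \1_(A l) x.
have mA l : measurable (A l) by rewrite -[X in measurable X]setTI; apply: mf.
have c0 l : 0 <= c l by rewrite mulr_ge0// ltW.
have mg : measurable_fun setT g.
  by apply: measurable_sum => l; apply: measurable_funM.
have fd0 x : 0 <= f x / delta.
  by have /andP[fx0 _] := fB x; exact: divr_ge0 fx0 (ltW delta0).
have lP x : (Num.truncn (f x / delta) < N)%N.
  rewrite ltnS le_truncn// ler_pM2r ?invr_gt0//; by have /andP[] := fB x.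
have fP x : (Num.truncn (f x / delta))%:R * delta <= f x <
    (Num.truncn (f x / delta)).+1%:R * delta.
  have := truncn_itv (fd0 x).
  by rewrite ler_pdivlMr// ltr_pdivrMr.
have gE x : g x = (Num.truncn (f x / delta)).+1%:R * delta.
  rewrite /g (bigD1 (Ordinal (lP x)))//= indicE mem_set ?mulr1; last first.
    by rewrite /A /= in_itv/=; exact: fP.
  rewrite big1 ?addr0// => l lx; rewrite indicE memNset ?mulr0//.
  rewrite /A /= in_itv/= => /andP[h1 h2]; move/eqP: lx; apply; apply/val_inj => /=.
  apply/esym/eqP; rewrite truncn_eq// ler_pdivlMr// ltr_pdivrMr//.
  exact/andP.
have gf x : f x <= g x <= f x + delta.
  by have /andP[h1 h2] := fP x; rewrite gE; move: h1 h2; rewrite -natr1 mulrDl; lra.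
have g0 x : 0 <= g x by rewrite gE mulr_ge0// ltW.
have igE : \int[mu]_x g x = \sum_l c l * fine (mu (A l)).
  rewrite /Rintegral /g.
  have -> : (fun x => (\sum_l c l * \1_(A l) x)%:E) =
      (fun x => \sum_l (c l * \1_(A l) x)%:E)%E by apply/funext => x; rewrite sumEFin.
  rewrite ge0_integral_sum//; first last.
  - by move=> l x _; rewrite lee_fin mulr_ge0.
  - by move=> l; apply/measurable_EFinP; apply: measurable_funM => //; exact: measurable_indic.
  rewrite -[RHS]/(fine _%:E) -sumEFin; congr fine; apply: eq_bigr => l _.
  under eq_integral do rewrite EFinM.
  rewrite ge0_integralZl//; first last.
  - by rewrite lee_fin.
  - by apply/measurable_EFinP; exact: measurable_indic.
  rewrite integral_indic// setIT [RHS]EFinM; congr (_ * _)%E; apply/esym/fineK.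
  exact: fin_num_measure.
apply: (@le_trans _ _ (\int[P]_w (\prod_i g (X i w))%:E)%E).
  apply: ge0_le_integralT => w; rewrite lee_fin.
    by rewrite prodr_ge0// => i _; have /andP[] := fB (X i w).
  apply: ler_prod => i _; have /andP[-> _] := fB (X i w).
  by have /andP[] := gf (X i w).
rewrite /g iid_simple_expectation// -igE lee_fin.
have fi : mu.-integrable setT (EFin \o f).
  apply: (@bounded_integrable _ _ _ mu _ B) => // x.
  by have /andP[? ?] := fB x; rewrite ger0_norm.
have ci : mu.-integrable setT (EFin \o cst delta).
  by apply: (@bounded_integrable _ _ _ mu _ `|delta|).
have gi : mu.-integrable setT (EFin \o g).
  apply: (@bounded_integrable _ _ _ mu _ (B + delta)) => // x.
  rewrite ger0_norm//; have /andP[_ ?] := gf x; have /andP[_ ?] := fB x; lra.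
rewrite lerXn2r ?nnegrE//.
- by apply: Rintegral_ge0.
- rewrite addr_ge0 ?(ltW delta0)//.
  by apply: Rintegral_ge0 => x _; have /andP[] := fB x.
rewrite -[in leRHS](Rintegral_probability_cst mu delta) -RintegralD//.
apply: le_Rintegral => //.
  by apply: (@bounded_integrable _ _ _ mu _ (B + delta)) => [|x];
    [exact: measurable_funD|have /andP[? ?] := fB x; rewrite ger0_norm; lra].
by move=> x _; have /andP[] := gf x.
Qed.

End iid_moments.

(** * Expected deviation over a finite class of functions *)

Lemma expR_le_quadratic {R : realType} (x : R) : x <= 2^-1 ->
  expR x <= 1 + x + 2 * x ^+ 2.
Proof.
move=> x2; have x1 : 0 < 1 - x by lra.
(* Multiply by 1 - x, which is positive and at most exp (- x). *)
rewrite -(ler_pM2r x1); apply: (@le_trans _ _ 1); last nra.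
rewrite -[leRHS](expRxMexpNx_1 x) ler_wpM2l ?expR_ge0//.
exact: expR_ge1Dx.
Qed.

Section empirical_process.
Context {dO dT : measure_display} {Omega : measurableType dO}.
Context {T : measurableType dT} {R : realType}.
Variables (P : probability Omega R) (mu : probability T R).
Variables (n : nat) (X : 'I_n -> {RV P >-> T}).
Hypothesis iidX : iid_sample mu X.

(** Hoeffding's bound up to constants: the linear term of
[expR_le_quadratic] integrates to zero because a - h is centred, and the
discretisation loss of [iid_product_le] is chosen of the size of the quadratic
term. *)
Lemma exponential_moment (h : T -> R) (B s : R) : 0 < s -> 0 < B ->
  4 * s * B <= 1 -> measurable_fun setT h -> (forall x, `|h x| <= B) ->
  (\int[P]_w (expR (s * \sum_i (\int[mu]_x h x - h (X i w))))%:E <=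
   (expR (n%:R * (9 * (s * B) ^+ 2)))%:E)%E.
Proof.
move=> s0 B0 sB mh hB; set a := \int[mu]_x h x.
have hi : mu.-integrable setT (EFin \o h).
  exact: (@bounded_integrable _ _ _ mu _ B).
have aB : `|a| <= B.
  have ci c : mu.-integrable setT (EFin \o cst c).
    exact: (@bounded_integrable _ _ _ mu _ `|c|).
  rewrite ler_norml -{1}(Rintegral_probability_cst mu (- B)).
  rewrite -{2}(Rintegral_probability_cst mu B).
  apply/andP; split; apply: le_Rintegral => //; try exact: ci;
    by move=> x _; have := hB x; rewrite ler_norml => /andP[].
pose f x := expR (s * (a - h x)).
have sh x : `|s * (a - h x)| <= 2 * (s * B).
  rewrite normrM gtr0_norm//; have := ler_normB a (h x); have := hB x.
  move: aB s0; nra.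
have fB x : 0 <= f x <= expR 2^-1.
  rewrite expR_ge0 ler_expR (le_trans (ler_norm _))// (le_trans (sh x))//; lra.
have mf : measurable_fun setT f.
  apply: measurableT_comp => //; apply: measurable_funM => //.
  exact: measurable_funB.
have d0 : 0 < (s * B) ^+ 2 by rewrite exprn_gt0// mulr_gt0.
have := @iid_product_le _ _ _ _ _ P mu n X iidX f _ _ d0 mf fB.
rewrite (_ : (fun w => _) = (fun w => (expR (s * \sum_i (a - h (X i w))))%:E)); last first.
  by apply/funext => w; rewrite mulr_sumr expR_sum.
move=> /le_trans; apply; rewrite lee_fin expRM_natl.
have i0 : 0 <= \int[mu]_x f x by apply: Rintegral_ge0 => x _; exact: expR_ge0.
rewrite lerXn2r ?nnegrE ?expR_ge0//; first by rewrite addr_ge0// ltW.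
apply: le_trans (expR_ge1Dx _).
suff : \int[mu]_x f x <= 1 + 8 * (s * B) ^+ 2 by lra.
have ai : mu.-integrable setT (EFin \o (fun x => s * a + (1 + 8 * (s * B) ^+ 2))).
  by apply: (@bounded_integrable _ _ _ mu _ `|s * a + (1 + 8 * (s * B) ^+ 2)|).
have shi : mu.-integrable setT (EFin \o (fun x => s * h x)).
  apply: (@bounded_integrable _ _ _ mu _ (s * B)) => [|x].
    exact: measurable_funM.
  by rewrite normrM gtr0_norm// ler_pM2l.
have -> : 1 + 8 * (s * B) ^+ 2 =
    \int[mu]_x (s * a + (1 + 8 * (s * B) ^+ 2) - s * h x).
  rewrite RintegralB// Rintegral_probability_cst RintegralZl// -/a; lra.
apply: le_Rintegral => //.
- apply: (@bounded_integrable _ _ _ mu _ (expR 2^-1)) => // x.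
  by rewrite ger0_norm ?expR_ge0//; have /andP[] := fB x.
- exact: (integrableB measurableT ai shi).
move=> x _; apply: le_trans (expR_le_quadratic _) _.
  rewrite (le_trans (ler_norm _))// (le_trans (sh x))//; lra.
have : (s * (a - h x)) ^+ 2 <= (2 * (s * B)) ^+ 2.
  by move: (s * (a - h x)) (sh x) => t; rewrite ler_norml => /andP[? ?]; nra.
lra.
Qed.

(** The union bound in expectation: with S the centred sum, s S is at most
alpha - 1 + exp (s S - alpha) by the tangent line of exp, and the sum of the
exponentials over the class has expectation at most exp alpha. The majorant F
is explicit, hence measurable. *)
Lemma empirical_process_bound (K : finType) (h : K -> T -> R) (B s beta : R) :
  (0 < n)%N -> 0 < s -> 0 < B -> 4 * s * B <= 1 ->
  (forall k, measurable_fun setT (h k)) -> (forall k x, `|h k x| <= B) ->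
  #|K|%:R <= expR beta -> 1 <= beta ->
  exists F : Omega -> R,
    [/\ measurable_fun setT F, forall w, 0 <= F w,
        forall k w, \int[mu]_x h k x - n%:R^-1 * \sum_i h k (X i w) <= F w &
        (\int[P]_w (F w)%:E <=
         ((beta + n%:R * (9 * (s * B) ^+ 2)) / (n%:R * s))%:E)%E].
Proof.
move=> n0 s0 B0 sB mh hB Kb b1.
have nR : 0 < n%:R :> R by rewrite ltr0n.
pose q := n%:R * (9 * (s * B) ^+ 2) : R; pose alpha := beta + q.
have q0 : 0 <= q by rewrite /q mulr_ge0// mulr_ge0// sqr_ge0.
pose S k w := \sum_i (\int[mu]_x h k x - h k (X i w)).
have mS k : measurable_fun setT (S k).
  apply: measurable_sum => i; apply: measurable_funB => //.
  exact: (measurableT_comp (mh k)).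
pose E k w := expR (s * S k w).
have mE k : measurable_fun setT (E k).
  by apply: measurableT_comp => //; exact: measurable_funM.
have ns0 : 0 < n%:R * s by exact: mulr_gt0.
pose F w := (n%:R * s)^-1 * (alpha - 1 + expR (- alpha) * \sum_k E k w).
have E0 k w : 0 <= E k w by exact: expR_ge0.
have F0 w : 0 <= F w.
  rewrite /F mulr_ge0 ?invr_ge0 ?(ltW ns0)// addr_ge0//; first by rewrite /alpha; lra.
  by rewrite mulr_ge0 ?expR_ge0// sumr_ge0.
have mF : measurable_fun setT F.
  apply: measurable_funM => //; apply: measurable_funD => //.
  by apply: measurable_funM => //; exact: measurable_sum.
exists F; split => // [k w|].
  have SE : \int[mu]_x h k x - n%:R^-1 * \sum_i h k (X i w) = n%:R^-1 * S k w.
    rewrite /S sumrB sumr_const card_ord mulrBr; congr (_ - _).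
    by rewrite -[X in _ = _ * X]mulr_natl mulrA mulVf ?mul1r// gt_eqF.
  rewrite SE /F invfM -mulrA ler_pM2l ?invr_gt0// ler_pdivlMl//.
  have h1 := expR_ge1Dx (s * S k w - alpha).
  have h2 : expR (s * S k w - alpha) <= expR (- alpha) * \sum_k E k w.
    rewrite addrC expRD ler_pM2l ?expR_gt0// (bigD1 k)//= lerDl sumr_ge0//.
  lra.
have -> : (fun w => (F w)%:E) = (fun w => (n%:R * s)^-1%:E *
    ((alpha - 1)%:E + (expR (- alpha))%:E * \sum_k (E k w)%:E))%E.
  by apply/funext => w; rewrite sumEFin -EFinM.
rewrite ge0_integralZl//; first last.
- by rewrite lee_fin invr_ge0 ltW.
- move=> w _; rewrite sumEFin -EFinM -EFinD lee_fin addr_ge0//.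
    by rewrite /alpha; lra.
  by rewrite mulr_ge0 ?expR_ge0// sumr_ge0.
- apply: emeasurable_funD => //; apply: emeasurable_funM => //.
  by apply: emeasurable_sum => k; exact/measurable_EFinP.
rewrite ge0_integralD//; first last.
- apply: emeasurable_funM => //.
  by apply: emeasurable_sum => k; exact/measurable_EFinP.
- by move=> w _; rewrite sumEFin -EFinM lee_fin mulr_ge0 ?expR_ge0// sumr_ge0.
- by move=> w _; rewrite lee_fin /alpha; lra.
rewrite integral_cst// [X in (_ * X + _)%E]probability_setT mule1.
rewrite ge0_integralZl//; first last.
- by move=> w _; rewrite sumEFin lee_fin sumr_ge0.
- by apply: emeasurable_sum => k; exact/measurable_EFinP.
rewrite ge0_integral_sum//; first last.
- by move=> k w _; rewrite lee_fin.
- by move=> k; exact/measurable_EFinP.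
have le1 : (\sum_k \int[P]_w (E k w)%:E <= (expR alpha)%:E)%E.
  apply: (@le_trans _ _ (\sum_(k : K) (expR q)%:E)%E).
    by apply: lee_sum => k _; exact: exponential_moment.
  rewrite sumEFin sumr_const lee_fin -[leLHS]mulr_natl /alpha expRD.
  by rewrite ler_wpM2r ?expR_ge0.
rewrite [leRHS]EFinM [leRHS]muleC lee_wpmul2l ?lee_fin ?invr_ge0 ?(ltW ns0)//.
apply: (@le_trans _ _ ((alpha - 1)%:E + (expR (- alpha))%:E * (expR alpha)%:E)%E).
  by rewrite leeD2l// lee_wpmul2l// lee_fin expR_ge0.
by rewrite -EFinM -expRD addNr expR0 -EFinD lee_fin subrK.
Qed.

End empirical_process.

(** * Oscillation of minimisers and integrals against discrete measures *)

Section minimiser_oscillation.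
Context {R : realType} {d p : nat}.
Variables (y : 'I_p.+1 -> 'rV[R]_d) (b : 'I_p.+1 -> R) (r : R).
Hypothesis y_ball : forall k, eball r (y k).
Hypothesis b_gt0 : forall k, 0 < b k.

(** If psi_k - psi_j were too large, the affine function of index j would stay
below that of index k on the whole ball with some room t. Raising psi_j by t
would then leave the average unchanged and decrease the objective by t b_j. The
average is only assumed to depend on values in the ball, so as to cover both
mu and the empirical measure. *)
Lemma minimiser_oscillation (ave : ('I_p.+1 -> R) -> R) psi :
  (forall psi1 psi2, (forall x, eball r x ->
     max_affine y psi1 x = max_affine y psi2 x) -> ave psi1 = ave psi2) ->
  (forall psi', ave psi - \sum_k psi k * b k <= ave psi' - \sum_k psi' k * b k) ->
  forall j k, psi k - psi j <= 2 * (d%:R * r ^+ 2).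
Proof.
move=> local min j k; rewrite leNgt; apply/negP => gap.
set K := d%:R * r ^+ 2 in gap; pose t := psi k - psi j - 2 * K.
have t0 : 0 < t by rewrite /t; lra.
pose psi' l := psi l + (if l == j then t else 0).
have := min psi'; rewrite (local psi' psi).
  rewrite lerD2l lerN2 (bigD1 j)//= [leRHS](bigD1 j)//=.
  rewrite {1}/psi' eqxx (eq_bigr (fun l => psi l * b l)); last first.
    by move=> l /negbTE lj; rewrite /psi' lj addr0.
  by rewrite lerD2r mulrDl gerDl; have := mulr_gt0 t0 (b_gt0 j); lra.
move=> x xr; apply/eqP; rewrite eq_le; apply/andP; split; last first.
  apply: max_affine_le => l; apply: le_trans (affine_le_max y psi' l x).
  by rewrite /affine /psi' lerD2l lerDl; case: ifP => // _; exact: ltW.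
apply: max_affine_le => l; rewrite /affine /psi'; case: eqP => [->|_]; last first.
  by rewrite addr0; exact: affine_le_max.
apply: le_trans (affine_le_max y psi k x); rewrite /affine.
have := dotrV_ball_le xr (y_ball j); have := dotrV_ball_le xr (y_ball k).
rewrite -/K !ler_norml /t; lra.
Qed.

End minimiser_oscillation.

Section discrete_integral.
Context {R : realType} {dT} {T : measurableType dT} {p : nat}.
Variables (nu : {measure set T -> \bar R}) (b : 'I_p.+1 -> R) (y : 'I_p.+1 -> T).
Hypothesis b_gt0 : forall k, 0 < b k.
Hypothesis nuE : forall A, measurable A -> nu A = (\sum_k (b k)%:E * \d_(y k) A)%E.
Local Open Scope ereal_scope.

Let b_ge0 k : (0 <= b k)%R. Proof. exact: ltW. Qed.

Lemma ge0_integral_discrete (f : T -> \bar R) : measurable_fun setT f ->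
  (forall x, 0 <= f x) -> \int[nu]_x f x = \sum_k (b k)%:E * f (y k).
Proof.
move=> mf f0.
pose m_ (k : nat) : {measure set T -> \bar R} :=
  mscale (NngNum (b_ge0 (inord k))) \d_(y (inord k)).
rewrite (eq_measure_integral (msum m_ p.+1)); last first.
  move=> A mA _; rewrite nuE// /msum/=; apply: eq_bigr => k _.
  by rewrite /mscale/= inord_val.
rewrite ge0_integral_measure_sum//; apply: eq_bigr => k _.
rewrite ge0_integral_mscale// integral_dirac//= inord_val.
by rewrite diracT mul1e.
Qed.

Lemma integral_discrete (f : T -> \bar R) : measurable_fun setT f ->
  (forall k, f (y k) != -oo) -> \int[nu]_x f x = \sum_k (b k)%:E * f (y k).
Proof.
move=> mf fNy; rewrite integralE.
rewrite ge0_integral_discrete//; last exact: measurable_funepos.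
rewrite ge0_integral_discrete//; last exact: measurable_funeneg.
have nfin k : (f^\- (y k)) \is a fin_num.
  rewrite funenegE; case: (f (y k)) (fNy k) => [c| |]//= _.
    by rewrite -EFin_max.
  by rewrite maxNye.
have bfin k : (b k)%:E * f^\- (y k) \is a fin_num by rewrite fin_numM.
rewrite -sumeN; last by move=> i j _ _; rewrite fin_num_adde_defr.
rewrite -big_split/=; apply: eq_bigr => k _.
have fE : f (y k) = f^\+ (y k) - f^\- (y k) by rewrite [in LHS](funeposneg f).
rewrite -muleN -muleDr// -?fE//.
by rewrite fin_num_adde_defl// fin_numN.
Qed.

End discrete_integral.

(** * Supports, and max-affine functions as convex potentials *)

Section ball_support.
Context {R : realType} {d : nat}.

Lemma eball_measurable (r : R) : 0 < r -> measurable (@eball R d r).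
Proof.
move=> r0; have -> : eball r = (fun x : 'rV[R]_d => dotrV x x) @^-1` `]-oo, (r ^+ 2)[%classic.
  have E x : (enorm x < r) = (dotrV x x < r ^+ 2).
    by rewrite /enorm -{1}(gtr0_norm r0) -sqrtr_sqr ltr_sqrt ?exprn_gt0.
  by apply/seteqP; split => x; rewrite /eball /= in_itv/= E.
rewrite -[X in measurable X]setTI.
have : measurable_fun [set: 'rV[R]_d] (fun x => dotrV x x).
  by apply: measurable_sum => i; apply: measurable_funM; exact: measurable_fun_coord.
by apply=> //; exact: measurable_itv.
Qed.

Lemma eball_sub_cube (r : R) : @eball R d r `<=` cube r.
Proof.
move=> x /= xr i /=; rewrite in_itv/= -ler_norml.
exact: le_trans (coord_le_enorm x i) (ltW xr).
Qed.

Lemma eball_full (r : R) (mu : probability 'rV[R]_d R) : 0 < r ->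
  mu (eball r) = 1%E -> mu (~` eball r) = 0%E.
Proof.
move=> r0 mu1; have mb := eball_measurable r0.
by rewrite (probability_setC mu mb) mu1 subee.
Qed.

Lemma cube_full (r : R) (mu : probability 'rV[R]_d R) : 0 < r ->
  mu (eball r) = 1%E -> mu (~` cube r) = 0%E.
Proof.
move=> r0 mu1; apply: (subset_measure0 _ _ _ (eball_full r0 mu1)).
- by apply: measurableC; exact: cube_measurable.
- by apply: measurableC; exact: eball_measurable.
- by apply: subsetC; exact: eball_sub_cube.
Qed.

Lemma discrete_support (nu : probability 'rV[R]_d R) m (b : 'I_m -> R)
    (y : 'I_m -> 'rV[R]_d) (r : R) : 0 < r -> nu (eball r) = 1%E ->
  (forall k, 0 < b k) ->
  (forall A, measurable A -> nu A = (\sum_k (b k)%:E * \d_(y k) A)%E) ->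
  forall k, eball r (y k).
Proof.
move=> r0 nu1 b0 nuE k; have := eball_full r0 nu1.
have mc : measurable (~` @eball R d r) by apply: measurableC; exact: eball_measurable.
rewrite nuE// => /eqP; rewrite seq_psume_eq0; last first.
  by move=> l _; rewrite mule_ge0// lee_fin ltW.
move=> /allP/(_ k (mem_index_enum _))/=; rewrite mule_eq0 eqe gt_eqF//= diracE.
have [//|yk] := pselect (eball r (y k)).
by rewrite mem_set//= onee_eq0.
Qed.

End ball_support.

Section max_affine_Gamma0.
Context {R : realType} {d p : nat}.
Variable y : 'I_p.+1 -> 'rV[R]_d.
Implicit Types psi : 'I_p.+1 -> R.
Local Open Scope ereal_scope.

Lemma Gamma0_max_affine psi : Gamma0 (EFin \o max_affine y psi).
Proof.
split.
- by split => [//|]; exists 0%R; rewrite /= ltry.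
- move=> x a /=; have [k kE] := max_affine_attained y psi x.
  rewrite kE lte_fin => ax; exists [set z | a < affine y psi k z]%R; last first.
    by move=> z /= az; rewrite lte_fin (lt_le_trans az)// affine_le_max.
  have cz : {for x, continuous (affine y psi k)}.
    by apply: continuousD; [exact: continuous_dotrV|exact: cst_continuous].
  apply: (cz [set t | a < t]%R); apply: open_nbhs_nbhs; split; last exact: ax.
  exact: open_gt.
- move=> x z t t01 /=; rewrite -!EFinM -EFinD lee_fin.
  exact: max_affine_convex.
Qed.

Lemma conjugate_max_affine_le psi k :
  conjugate (EFin \o max_affine y psi) (y k) <= (- psi k)%:E.
Proof.
apply: ge_ereal_sup => _ [x _ <-] /=; rewrite -EFinB lee_fin.
by have := affine_le_max y psi k x; rewrite /affine; lra.
Qed.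

Lemma conjugate_gtNy (phi : 'rV[R]_d -> \bar R) z : proper_fun phi ->
  conjugate phi z != -oo.
Proof.
move=> [phiNy [x xfin]]; rewrite -ltNye.
apply: (@lt_le_trans _ _ ((dotrV x z)%:E - phi x)); last first.
  by apply: ereal_sup_ubound; exists x.
by have := phiNy x; case: (phi x) xfin => // c _ _; rewrite -EFinB ltNye.
Qed.

Lemma fenchel (phi : 'rV[R]_d -> \bar R) psi : (forall x, phi x != -oo) ->
  (forall k, conjugate phi (y k) = (- psi k)%:E) ->
  forall k x, (affine y psi k x)%:E <= phi x.
Proof.
move=> phiNy cE k x; case phiE : (phi x) (phiNy x) => [c| |] // _; last exact: leey.
have : (dotrV x (y k))%:E - phi x <= conjugate phi (y k).
  by apply: ereal_sup_ubound; exists x.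
by rewrite phiE cE -EFinB !lee_fin /affine; lra.
Qed.

End max_affine_Gamma0.

(** * Optimal potentials are max-affine almost everywhere *)

Section semidual_problem.
Context {R : realType} {d p : nat}.
Variables (mu nu : probability 'rV[R]_d R).
Variables (y : 'I_p.+1 -> 'rV[R]_d) (b : 'I_p.+1 -> R) (r : R).
Hypothesis r0 : 0 < r.
Hypothesis mu_ball : mu (eball r) = 1%E.
Hypothesis y_ball : forall k, eball r (y k).
Hypothesis b_gt0 : forall k, 0 < b k.
Hypothesis nuE : forall A, measurable A -> nu A = (\sum_k (b k)%:E * \d_(y k) A)%E.
Implicit Types psi : 'I_p.+1 -> R.

Definition semidual psi : R :=
  \int[mu]_x max_affine y psi x - \sum_k psi k * b k.

Lemma integrable_max_affine psi : mu.-integrable setT (EFin \o max_affine y psi).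
Proof.
apply: (@ae_bounded_integrable _ _ _ mu (eball r) _
  (d%:R * r ^+ 2 + \sum_k `|psi k|)) => //.
- exact: eball_measurable.
- exact: eball_full.
- exact: measurable_max_affine.
move=> x xr; have [k ->] := max_affine_attained y psi x.
apply: le_trans (ler_normD _ _) _; apply: lerD; first exact: dotrV_ball_le.
by rewrite (bigD1 k)//= lerDl sumr_ge0.
Qed.

Lemma integral_max_affineE psi :
  (\int[mu]_x (max_affine y psi x)%:E)%E = (\int[mu]_x max_affine y psi x)%:E.
Proof.
by rewrite /Rintegral fineK//; apply: integrable_fin_num => //; exact: integrable_max_affine.
Qed.

Lemma brenier_max_affine_le psi :
  (brenier_functional mu nu (EFin \o max_affine y psi) <= (semidual psi)%:E)%E.
Proof.
rewrite /brenier_functional /= integral_max_affineE /semidual EFinB leeD2l//.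
have [pr _ _] := Gamma0_max_affine y psi.
rewrite (integral_discrete b_gt0 nuE); first last.
- by move=> k; exact: conjugate_gtNy.
- by apply: lower_semicontinuous_measurable_rV; exact: conjugate_lsc.
rewrite -EFinN -sumrN -sumEFin; apply: lee_sum => k _.
rewrite -mulNr [(- _ * _)%R]mulrC EFinM lee_wpmul2l ?lee_fin ?(ltW (b_gt0 k))//.
exact: conjugate_max_affine_le.
Qed.

(** A lower semicontinuous function is bounded below on the compact cube. *)
Lemma lsc_integral_gtNy (phi : 'rV[R]_d -> \bar R) : (forall x, phi x != -oo%E) ->
  lower_semicontinuous phi -> (\int[mu]_x phi^\- x < +oo)%E.
Proof.
move=> phiNy lphi; have mphi := lower_semicontinuous_measurable_rV lphi.
have [c hc] := lsc_cube_lower_bound r phiNy lphi.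
apply: (@le_lt_trans _ _ (\int[mu]_x (cst `|c|%:E x))%E).
  apply: (@ae_le_integralT _ _ _ mu _ _ (~` eball r)) => //.
  - by apply: measurableC; exact: eball_measurable.
  - exact: eball_full.
  - by move=> x; rewrite lee_fin.
  - move=> x /contrapT xr /=; rewrite funenegE ge_max lee_fin normr_ge0 andbT.
    have : (c%:E <= phi x)%E.
      by apply: hc => i; rewrite (le_trans (coord_le_enorm x i))// ltW.
    rewrite leeNl; apply: le_trans; rewrite -EFinN lee_fin.
    by rewrite lerNl ler_normr lexx orbT.
by rewrite integral_cst// [X in (_ * X)%E]probability_setT mule1 ltry.
Qed.

(** The weights psi_k = - phi^*(y_k) are finite since the optimal value is
finite, the integral of phi is not -oo, and every y_k has positive mass.
Comparing phi with [max_affine psi], which is below phi and has no larger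
conjugate at the y_k, shows that both have the same integral. *)
Lemma optimal_potential_max_affine (phi : 'rV[R]_d -> \bar R) :
  optimal_brenier_potential mu nu phi ->
  exists psi, [/\ forall k x, ((affine y psi k x)%:E <= phi x)%E,
    exists N, [/\ measurable N, mu N = 0%E &
      forall x, ~ N x -> phi x = (max_affine y psi x)%:E] &
    forall psi', semidual psi <= semidual psi'].
Proof.
move=> [[pr lphi cphi] opt].
have phiNy := pr.1; have mphi := lower_semicontinuous_measurable_rV lphi.
have Jle psi' : (brenier_functional mu nu phi <= (semidual psi')%:E)%E.
  apply: le_trans (brenier_max_affine_le psi'); rewrite opt.
  by apply: ereal_inf_lbound; exists (EFin \o max_affine y psi') => //; exact: Gamma0_max_affine.
have negfin := lsc_integral_gtNy phiNy lphi.
have intNy : (\int[mu]_x phi x != -oo)%E.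
  rewrite integralE -ltNye; apply: (@lt_le_trans _ _ (0 - \int[mu]_x phi^\- x)%E).
    by rewrite sub0e ltNye eqe_oppLR /= lt_eqF.
  by rewrite leeD2r// integral_ge0.
have cNy k : conjugate phi (y k) != -oo%E by exact: conjugate_gtNy.
have nuc : (\int[nu]_z conjugate phi z = \sum_k (b k)%:E * conjugate phi (y k))%E.
  apply: (integral_discrete b_gt0 nuE) => //.
  by apply: lower_semicontinuous_measurable_rV; exact: conjugate_lsc.
have bcNy k : ((b k)%:E * conjugate phi (y k) != -oo)%E.
  by case: (conjugate phi (y k)) (cNy k) => [c| |] // _; rewrite gt0_muley// lte_fin.
have cfin k : conjugate phi (y k) \is a fin_num.
  rewrite fin_numE cNy /=; apply/eqP => cy.
  have := Jle (fun=> 0); rewrite /brenier_functional nuc.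
  have -> : (\sum_k (b k)%:E * conjugate phi (y k) = +oo)%E.
    apply/eqP; rewrite esum_eqy//; apply/existsP; exists k.
    by rewrite cy gt0_muley// lte_fin.
  by rewrite addey.
pose psi k := - fine (conjugate phi (y k)).
have cE k : conjugate phi (y k) = (- psi k)%:E by rewrite /psi opprK fineK.
have phi_ge := fenchel phiNy cE.
have nucE : (\int[nu]_z conjugate phi z = (- \sum_k psi k * b k)%:E)%E.
  rewrite nuc -sumrN -sumEFin; apply: eq_bigr => k _.
  by rewrite cE -EFinM mulrN mulrC.
have intle psi' : (\int[mu]_x phi x <= (semidual psi' + \sum_k psi k * b k)%:E)%E.
  by have := Jle psi'; rewrite /brenier_functional nucE EFinN leeBlDr// -EFinD.
have posfin : (\int[mu]_x phi^\+ x < +oo)%E.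
  have := intle psi; rewrite integralE leeBlDr; last first.
    by rewrite ge0_fin_numE// integral_ge0.
  move=> /le_lt_trans; apply; rewrite lte_add_pinfty ?ltry//.
have phi_int : mu.-integrable setT phi.
  apply/integrableP; split => //.
  under eq_integral do rewrite -[`|_|%E]/((abse \o phi) _) fune_abse.
  rewrite ge0_integralD//; [|exact: measurable_funepos|exact: measurable_funeneg].
  by rewrite lte_add_pinfty.
have maxle x : ((max_affine y psi x)%:E <= phi x)%E.
  by have [k ->] := max_affine_attained y psi x.
have intge : ((\int[mu]_x max_affine y psi x)%:E <= \int[mu]_x phi x)%E.
  rewrite -integral_max_affineE; apply: le_integral => //.
  exact: integrable_max_affine.
have inteq : (\int[mu]_x phi x = (\int[mu]_x max_affine y psi x)%:E)%E.
  apply/eqP; rewrite eq_le intge andbT; apply: le_trans (intle psi) _.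
  by rewrite lee_fin /semidual subrK.
exists psi; split => //; last first.
  by move=> psi'; have := intle psi'; rewrite inteq lee_fin /semidual; lra.
pose D := (phi \- (EFin \o max_affine y psi))%E.
have mD : measurable_fun setT D.
  by apply: emeasurable_funB => //; apply/measurable_EFinP; exact: measurable_max_affine.
have : (\int[mu]_x `|D x| = 0)%E.
  transitivity (\int[mu]_x D x)%E.
    by apply: eq_integral => x _; rewrite gee0_abs// /D sube_ge0//= orbT.
  rewrite integralB//; last exact: integrable_max_affine.
  by rewrite inteq /= integral_max_affineE subee.
move/(ae_eq_integral_abs mu measurableT mD) => [N [mN N0 subN]].
exists N; split => // x xN.
have : D x = 0%E.
  by apply: contrapT => Dx; apply: xN; apply: subN => /= h; apply: Dx; exact: h.
rewrite /D /=; case: (phi x) (phiNy x) => [c| |]//= _.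
by rewrite -EFinB => -[/eqP]; rewrite subr_eq0 => /eqP ->.
Qed.

End semidual_problem.

(** * Gradients of optimal potentials *)

Lemma no_three_countable {R : realType} (E : set R) :
  (forall s t u, E s -> E t -> E u -> s < t -> t < u -> False) -> countable E.
Proof.
move=> E3; have [->|/set0P[s Es]] := eqVneq E set0; first exact: countable0.
have [Es1|/existsNP[t /not_implyP[Et ts]]] := pselect (forall t, E t -> t = s).
  by rewrite (_ : E = [set s])//; apply/seteqP; split => // t ->.
apply: (@sub_countable _ _ _ [set s; t]); last first.
  exact/finite_set_countable/finite_set2.
apply: subset_card_le => u Eu; apply: contrapT => /not_orP[/= us ut].
move/eqP: ts; move/eqP: us; move/eqP: ut.
case: (ltgtP u t) => // ut _; case: (ltgtP u s) => // us _;
  case: (ltgtP t s) => // ts _;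
  by [apply: (E3 u t s)|apply: (E3 u s t)|apply: (E3 t u s)|apply: (E3 s u t)
     |apply: (E3 t s u)|apply: (E3 s t u)|lra].
Qed.

Section gradient.
Context {R : realType} {d p : nat}.
Variables (y : 'I_p.+1 -> 'rV[R]_d) (psi : 'I_p.+1 -> R).
Variable phi : 'rV[R]_d -> \bar R.
Hypothesis cphi : convex_efun phi.
Hypothesis phi_ge : forall k x, ((affine y psi k x)%:E <= phi x)%E.

Definition contact k : set 'rV[R]_d := [set x | (phi x <= (affine y psi k x)%:E)%E].

Lemma contactE k x : contact k x -> phi x = (affine y psi k x)%:E.
Proof. by move=> xk; apply/eqP; rewrite eq_le xk phi_ge. Qed.

Lemma contact_convex k x z (t : R) : 0 <= t <= 1 -> contact k x -> contact k z ->
  contact k (t *: x + (1 - t) *: z).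
Proof.
move=> t01 kx kz; have := cphi x z t01.
rewrite (contactE kx) (contactE kz) -!EFinM -EFinD => /le_trans; apply.
rewrite lee_fin /affine dotrVDl !dotrVZl; lra.
Qed.

Lemma contact_segment k x (u : 'rV[R]_d) (s t v : R) : s <= v -> v <= t ->
  contact k (x + s *: u) -> contact k (x + t *: u) -> contact k (x + v *: u).
Proof.
move=> sv vt ks kt; have [st|st] := ltP s t; last first.
  by rewrite (_ : v = s)//; lra.
have ts0 : 0 < t - s by lra.
pose l := (v - s) / (t - s).
have l01 : 0 <= l <= 1.
  by rewrite /l divr_ge0 ?subr_ge0 ?(ltW st)//= ler_pdivrMr//; lra.
have lE : l * (t - s) = v - s by rewrite /l divfK// gt_eqF.
have := contact_convex l01 kt ks.
rewrite (_ : l *: (x + t *: u) + _ = x + v *: u)//.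
rewrite !scalerDr !scalerA addrACA -!scalerDl.
have -> : l + (1 - l) = 1 by lra.
rewrite scale1r; congr (_ + _ *: _); lra.
Qed.

(** The potential is affine on the whole segment between two contact points. *)
Lemma contact_derive k x i (h : R) : 0 < h ->
  contact k (x + (- h) *: delta_mx ord0 i) -> contact k (x + h *: delta_mx ord0 i) ->
  'D_(delta_mx ord0 i) (fine \o phi) x = y k ord0 i.
Proof.
move=> h0 kl kr.
have kE s : `|s| <= h -> (fine \o phi) (s *: delta_mx ord0 i + x) =
    affine y psi k x + s * y k ord0 i.
  move=> sh; rewrite /= addrC (contactE (k := k)).
    by rewrite /= /affine dotrVDl dotrVZl dotrV_delta addrAC.
  by move: sh; rewrite ler_norml => /andP[? ?]; exact: (contact_segment (s := - h) (t := h)).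
have k0 : (fine \o phi) x = affine y psi k x.
  by have := kE 0; rewrite normr0 scale0r add0r mul0r addr0 ltW//; exact.
apply/cvg_lim => //.
apply: (@cvg_trans _ ((fun=> y k ord0 i : R) @ (0 : R)^')); last exact: cvg_cst.
apply: near_eq_cvg; near=> s.
have s0 : s != 0 by near: s; exact: nbhs_dnbhs_neq.
rewrite /shift /= -[fine (phi _)]/((fine \o phi) _) kE; last first.
  by near: s; exact: dnbhs0_le.
rewrite -[fine (phi x)]/((fine \o phi) x) k0 addrAC subrr add0r.
by rewrite -[_ *: _]/(_ * _) mulrA mulVf// mul1r.
Unshelve. all: by end_near. Qed.

(** The contact points at which the contact set extends in direction i on at
most one side. Only the steps 1/(l+1) are used, to keep the union countable. *)
Definition contact_edge k (i : 'I_d) : set 'rV[R]_d :=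
  contact k `\` \bigcup_(l : nat)
    ((fun x => x + (- l.+1%:R^-1) *: delta_mx ord0 i) @^-1` contact k `&`
     (fun x => x + l.+1%:R^-1 *: delta_mx ord0 i) @^-1` contact k).

(** By convexity, of three points of a slice the middle one is not an edge. *)
Lemma contact_edge_slice k i x :
  countable [set t | contact_edge k i (set_coord i t x)].
Proof.
apply: no_three_countable => s t u [/= sk _] [/= tk tedge] [/= uk _] st tu.
apply: tedge; have m0 : 0 < Num.min (t - s) (u - t) by rewrite lt_min !subr_gt0 st.
have [l _ /(_ l (leqnn l)) /= lm] := near_infty_natSinv_lt (PosNum m0).
have l0 : 0 < l.+1%:R^-1 :> R by rewrite invr_gt0.
have [h hE] : exists h : R, h = l.+1%:R^-1 by exists l.+1%:R^-1.
move: lm l0; rewrite -hE lt_min => /andP[hs hu] h0.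
exists l => //; rewrite /= -hE; move: sk uk.
rewrite (set_coordE i s) (set_coordE i t) (set_coordE i u) => sk uk.
by rewrite -!addrA -!scalerDl; split;
  apply: contact_segment sk uk; lra.
Qed.

Hypothesis mphi : measurable_fun setT phi.

Lemma measurable_contact k : measurable (contact k).
Proof.
rewrite -[contact k]setTI; apply: measurable_lee => //.
by apply/measurable_EFinP; apply: measurable_funD => //; exact: measurable_dotrV.
Qed.

Lemma measurable_contact_edge k i : measurable (contact_edge k i).
Proof.
apply: measurableD; first exact: measurable_contact.
apply: bigcup_measurable => l _; apply: measurableI;
  rewrite -[X in measurable X]setTI; apply: measurable_translate => //;
  exact: measurable_contact.
Qed.

Section null.
Variables (mu : {measure set 'rV[R]_d -> \bar R}) (M r : R).
Hypothesis M0 : 0 <= M.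
Hypothesis r0 : 0 <= r.
Hypothesis mu_le : forall A, measurable A -> (mu A <= M%:E * lebesgue_rV d A)%E.
Hypothesis mu_cube : mu (~` cube r) = 0%E.

Lemma grad_max_affine_ae :
  exists N, [/\ measurable N, mu N = 0%E & forall x, ~ N x ->
    phi x = (max_affine y psi x)%:E ->
    exists k, max_affine y psi x = affine y psi k x /\ grad phi x = y k].
Proof.
exists (\bigcup_(ki in [set: 'I_p.+1 * 'I_d]) contact_edge ki.1 ki.2).
have mE : measurable (\bigcup_(ki in [set: 'I_p.+1 * 'I_d]) contact_edge ki.1 ki.2).
  by apply: fin_bigcup_measurable => // -[k i] _; exact: measurable_contact_edge.
split => //.
- apply/eqP; rewrite -measure_le0.
  have := @content_sub_fsum _ _ _ mu _ [set: 'I_p.+1 * 'I_d] _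
    (fun ki => contact_edge ki.1 ki.2) finite_finset.
  move=> /(_ _ _ mE (@subset_refl _ _)); rewrite fsbig1//.
    by apply => -[k i] _; exact: measurable_contact_edge.
  move=> [k i] _; apply: (slice_countable_null M0 r0 mu_le mu_cube (i := i)).
    exact: measurable_contact_edge.
  exact: contact_edge_slice.
move=> x xN xphi; have [k kE] := max_affine_attained y psi x.
exists k; split => //; have kx : contact k x by rewrite /contact /= xphi kE.
apply/rowP => i; rewrite /grad mxE.
have [l _ [/= kl kr]] : (\bigcup_(l : nat)
    ((fun x => x + (- l.+1%:R^-1) *: delta_mx ord0 i) @^-1` contact k `&`
     (fun x => x + l.+1%:R^-1 *: delta_mx ord0 i) @^-1` contact k)) x.
  by apply: contrapT => h; apply: xN; exists (k, i).
by apply: (@contact_derive k x i l.+1%:R^-1) => //; rewrite invr_gt0.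
Qed.

End null.

End gradient.

(** * Discrete duality and stability of the transport map *)

Section dual_problem.
Context {R : realType} {d n p : nat}.
Variables (x : 'I_n -> 'rV[R]_d) (y : 'I_p.+1 -> 'rV[R]_d) (b : 'I_p.+1 -> R).

(** The change of unknown from the quadratic cost to the scalar product. *)
Definition legendre_weights (g : 'I_p.+1 -> R) k : R := g k - 2^-1 * enorm (y k) ^+ 2.

Lemma potential_of_dualE g : potential_of_dual y g = EFin \o max_affine y (legendre_weights g).
Proof.
apply/funext => z /=; apply/eqP; rewrite eq_le; apply/andP; split.
  apply/bigmax_leP; split=> [|k _]; first exact: leNye.
  by rewrite lee_fin -addrA; exact: affine_le_max.
have [k ->] := max_affine_attained y (legendre_weights g) z.
rewrite /affine addrA; apply: (le_bigmax _
  (fun k => (dotrV z (y k) + g k - 2^-1 * enorm (y k) ^+ 2)%:E)).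
Qed.

Lemma subdifferential_dual g z q :
  subdifferential (potential_of_dual y g) z q ->
  subgradient y (legendre_weights g) z q.
Proof. by rewrite potential_of_dualE => h u; have := h u; rewrite /= -EFinD lee_fin. Qed.

Lemma enorm_sqr (v : 'rV[R]_d) : enorm v ^+ 2 = dotrV v v.
Proof.
by rewrite /enorm sqr_sqrtr// sumr_ge0// => i _; rewrite -expr2 sqr_ge0.
Qed.

Lemma half_enorm_sub (u v : 'rV[R]_d) : 2^-1 * enorm (u - v) ^+ 2 =
  2^-1 * enorm u ^+ 2 + 2^-1 * enorm v ^+ 2 - dotrV u v.
Proof.
rewrite !enorm_sqr dotrVDl dotrVNl ![dotrV _ (u - v)]dotrVC !dotrVDl !dotrVNl.
rewrite (dotrVC v u); lra.
Qed.

Definition empirical_mean (f : 'rV[R]_d -> R) : R := n%:R^-1 * \sum_i f (x i).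

(** Given psi, the pair f_i = |x_i|^2/2 - phi_psi(x_i) and
g_k = psi_k + |y_k|^2/2 is feasible, and for given g no feasible f exceeds the
one of this form. Expressed in psi, the dual value is a constant minus the
semi-dual objective of the empirical measure. *)
Lemma dual_optimal_minimiser f g psi : dual_optimal (fun=> n%:R^-1) x b y f g ->
  empirical_mean (max_affine y (legendre_weights g)) -
    \sum_k legendre_weights g k * b k <=
  empirical_mean (max_affine y psi) - \sum_k psi k * b k.
Proof.
move=> [feas opt].
pose f' i := 2^-1 * enorm (x i) ^+ 2 - max_affine y psi (x i).
pose g' k := psi k + 2^-1 * enorm (y k) ^+ 2.
have feas' : dual_feasible x y f' g'.
  move=> i k; rewrite half_enorm_sub /f' /g'.
  by have := affine_le_max y psi k (x i); rewrite /affine; lra.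
have f_le i : f i <= 2^-1 * enorm (x i) ^+ 2 - max_affine y (legendre_weights g) (x i).
  have [k ->] := max_affine_attained y (legendre_weights g) (x i).
  by have := feas i k; rewrite half_enorm_sub /affine /legendre_weights; lra.
have := opt _ _ feas'; rewrite /dual_value /empirical_mean !mulr_sumr.
have -> : \sum_k g' k * b k = \sum_k psi k * b k + \sum_k 2^-1 * enorm (y k) ^+ 2 * b k.
  by rewrite -big_split; apply: eq_bigr => k _; rewrite /g' /= mulrDl.
have -> : \sum_k g k * b k = \sum_k legendre_weights g k * b k +
    \sum_k 2^-1 * enorm (y k) ^+ 2 * b k.
  by rewrite -big_split; apply: eq_bigr => k _; rewrite /legendre_weights /= -mulrDl subrK.
have -> : \sum_i f' i * n%:R^-1 = \sum_i 2^-1 * enorm (x i) ^+ 2 * n%:R^-1 -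
    \sum_i n%:R^-1 * max_affine y psi (x i).
  by rewrite -sumrB; apply: eq_bigr => i _; rewrite /f' mulrBl [max_affine _ _ _ * _]mulrC.
have : \sum_i f i * n%:R^-1 <= \sum_i 2^-1 * enorm (x i) ^+ 2 * n%:R^-1 -
    \sum_i n%:R^-1 * max_affine y (legendre_weights g) (x i).
  rewrite -sumrB; apply: ler_sum => i _.
  by rewrite [n%:R^-1 * _]mulrC -mulrBl ler_wpM2r// invr_ge0.
lra.
Qed.

End dual_problem.

Section map_stability.
Context {R : realType} {d p : nat}.
Variables (mu : probability 'rV[R]_d R).
Variables (y : 'I_p.+1 -> 'rV[R]_d) (b : 'I_p.+1 -> R) (M r : R).
Hypothesis M0 : 0 <= M.
Hypothesis r0 : 0 < r.
Hypothesis mu_ball : mu (eball r) = 1%E.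
Hypothesis mu_le : forall A, measurable A -> (mu A <= M%:E * lebesgue_rV d A)%E.
Hypothesis y_ball : forall k, eball r (y k).
Implicit Types psi : 'I_p.+1 -> R.

(** The weights enter the objective linearly except through the potential, so
minimality of psi against the midpoint is exactly this bound. *)
Lemma integral_jensen_gap_le psi psi' :
  (forall psi'', semidual mu y b psi <= semidual mu y b psi'') ->
  (\int[mu]_x (jensen_gap y psi psi' x)%:E <=
   (semidual mu y b psi' - semidual mu y b psi)%:E)%E.
Proof.
move=> min.
have im q : mu.-integrable setT (EFin \o max_affine y q).
  exact: (integrable_max_affine r0 mu_ball y_ball).
have gapE : (\int[mu]_x (jensen_gap y psi psi' x)%:E =
   (\int[mu]_x max_affine y psi x + \int[mu]_x max_affine y psi' x -
    2 * \int[mu]_x max_affine y (midpoint psi psi') x)%:E)%E.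
  rewrite /jensen_gap.
  have i2 : mu.-integrable setT (EFin \o (fun x => 2 * max_affine y (midpoint psi psi') x)).
    exact: (integrableZl measurableT 2 (im (midpoint psi psi'))).
  have E2 : (\int[mu]_x (2 * max_affine y (midpoint psi psi') x)%:E)%E =
      (2 * \int[mu]_x max_affine y (midpoint psi psi') x)%:E.
    under eq_integral do rewrite EFinM.
    by rewrite integralZl ?[X in (_ * X)%E](integral_max_affineE r0 mu_ball y_ball)//; exact: im.
  rewrite integralB_EFin//; last exact: (integrableD measurableT (im psi) (im psi')).
  by rewrite integralD_EFin// E2 !(integral_max_affineE r0 mu_ball y_ball).
rewrite gapE lee_fin; have := min (midpoint psi psi'); rewrite /semidual.
have -> : \sum_k midpoint psi psi' k * b k =
    2^-1 * (\sum_k psi k * b k + \sum_k psi' k * b k).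
  rewrite -big_split mulr_sumr; apply: eq_bigr => k _ /=; rewrite /midpoint; lra.
lra.
Qed.

(** The pointwise bound [subgradient_compare], summed over the coordinates, has
a measurable right-hand side, so q may be any selection. *)
Lemma map_stability (phi : 'rV[R]_d -> \bar R) psi psi' (q : 'rV[R]_d -> 'rV[R]_d) (h : R) :
  0 < h -> (forall psi'', semidual mu y b psi <= semidual mu y b psi'') ->
  (exists N, [/\ measurable N, mu N = 0%E & forall x, ~ N x ->
     exists k, max_affine y psi x = affine y psi k x /\ grad phi x = y k]) ->
  (forall x, subgradient y psi' x (q x)) ->
  (\int[mu]_x (enorm (grad phi x - q x))%:E <=
   (d%:R * ((semidual mu y b psi' - semidual mu y b psi) / h +
     2 * (M * (4 * r * (2 * r) ^+ d.-1)) * h))%:E)%E.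
Proof.
move=> h0 min [N [mN N0 gradE]] sq.
pose G i x := (h^-1 * (jensen_gap y psi psi' x +
  (second_diff y psi h i x + second_diff y psi' h i x)))%R.
have G0 i x : 0 <= G i x.
  apply: mulr_ge0; first by rewrite invr_ge0 ltW.
  apply: addr_ge0; first exact: jensen_gap_ge0.
  by apply: addr_ge0; exact: second_diff_ge0.
have mG i : measurable_fun setT (G i).
  apply: measurable_funM => //; apply: measurable_funD.
    exact: measurable_jensen_gap.
  by apply: measurable_funD; exact: measurable_second_diff.
apply: (@le_trans _ _ (\int[mu]_x (\sum_i (G i x)%:E))%E).
  apply: (@ae_le_integralT _ _ _ mu _ _ N) => //.
  - by apply: emeasurable_sum => i; exact/measurable_EFinP.
  - by move=> x; rewrite lee_fin sqrtr_ge0.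
  - by move=> x; apply: sume_ge0 => i _; rewrite lee_fin.
  move=> x xN; have [k [kE ->]] := gradE x xN.
  rewrite sumEFin lee_fin; apply: le_trans (enorm_le_sum _) _.
  apply: ler_sum => i _; rewrite !mxE.
  have := subgradient_compare i h0 (active_subgradient kE) (sq x).
  by rewrite /G mulrC !addrA.
rewrite ge0_integral_sum//; first last.
- by move=> i x _; rewrite lee_fin.
- by move=> i; exact/measurable_EFinP.
have Gi i : (\int[mu]_x (G i x)%:E <=
   ((semidual mu y b psi' - semidual mu y b psi) / h +
     2 * (M * (4 * r * (2 * r) ^+ d.-1)) * h)%:E)%E.
  have -> : (fun x => (G i x)%:E) = (fun x => h^-1%:E * ((jensen_gap y psi psi' x)%:E +
      ((second_diff y psi h i x)%:E + (second_diff y psi' h i x)%:E)))%E by [].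
  have mJ := measurable_jensen_gap y psi psi'.
  have mS q' : measurable_fun setT (fun x => (second_diff y q' h i x)%:E).
    by apply/measurable_EFinP; exact: measurable_second_diff.
  have J0 x : (0 <= (jensen_gap y psi psi' x)%:E)%E by rewrite lee_fin jensen_gap_ge0.
  have S0 q' x : (0 <= (second_diff y q' h i x)%:E)%E by rewrite lee_fin second_diff_ge0.
  rewrite ge0_integralZl//; first last.
  - by rewrite lee_fin invr_ge0 ltW.
  - by move=> x _; apply: adde_ge0; [exact: J0|apply: adde_ge0; exact: S0].
  - apply: emeasurable_funD; first exact/measurable_EFinP.
    by apply: emeasurable_funD; exact: mS.
  rewrite ge0_integralD//; first last.
  - by apply: emeasurable_funD; exact: mS.
  - by move=> x _; apply: adde_ge0; exact: S0.
  - exact/measurable_EFinP.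
  rewrite ge0_integralD//.
  pose S := M * (4 * h * (h * r) * (2 * r) ^+ d.-1).
  have yi k : `|y k ord0 i| <= r by rewrite (le_trans (coord_le_enorm _ _))// ltW//; exact: y_ball.
  have SS q' : (\int[mu]_x (second_diff y q' h i x)%:E <= S%:E)%E.
    apply: (integral_second_diff_le M0 (ltW r0) mu_le _ _ h0 yi).
    exact: cube_full.
  apply: (@le_trans _ _ (h^-1%:E * ((semidual mu y b psi' - semidual mu y b psi)%:E +
    (S%:E + S%:E)))%E).
    rewrite lee_wpmul2l ?lee_fin ?invr_ge0 ?(ltW h0)//.
    by rewrite leeD ?leeD//; exact: integral_jensen_gap_le.
  rewrite -!EFinD -EFinM lee_fin mulrDr [h^-1 * _]mulrC lerD2l.
  rewrite le_eqVlt; apply/orP; left; apply/eqP.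
  rewrite /S; field; exact: lt0r_neq0.
apply: (@le_trans _ _ (\sum_(i < d) ((semidual mu y b psi' - semidual mu y b psi) / h +
     2 * (M * (4 * r * (2 * r) ^+ d.-1)) * h)%:E)%E).
  by apply: lee_sum => i _; exact: Gi.
by rewrite sumEFin sumr_const card_ord -[X in (X%:E <= _)%E]mulr_natl.
Qed.

End map_stability.

(** * Discretisation of the weights *)

Lemma density_measure_le {R : realType} {d : nat} (mu : set 'rV[R]_d -> \bar R)
    (rho : 'rV[R]_d -> R) (M : R) :
  is_density mu rho -> (forall x, rho x <= M) ->
  forall A, measurable A -> (mu A <= M%:E * lebesgue_rV d A)%E.
Proof.
move=> [mrho rho0 muE] rhoM A mA; rewrite muE// -integral_cst//.
apply: ge0_le_integral => //.
- by move=> x _; rewrite lee_fin.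
- by apply/measurable_EFinP; exact: measurable_funTS.
- by move=> x _; rewrite lee_fin.
Qed.

Lemma eq_Rintegral_full {dT} {T : measurableType dT} {R : realType}
    (mu : probability T R) (A : set T) (f g : T -> R) : measurable A ->
  mu (~` A) = 0%E -> measurable_fun setT f -> measurable_fun setT g ->
  (forall x, A x -> f x = g x) -> \int[mu]_x f x = \int[mu]_x g x.
Proof.
move=> mA A0 mf mg fg; congr fine; apply: ae_eq_integral => //.
- exact/measurable_EFinP.
- exact/measurable_EFinP.
exists (~` A); split => //; first exact: measurableC.
by move=> x /= /not_implyP[_]; apply: contra_not => Ax; rewrite fg.
Qed.

Section grid.
Context {R : realType} {p : nat}.
Variables (K delta : R).
Hypothesis delta0 : 0 < delta.

Definition grid_size := (Num.truncn (4 * K / delta)).+1.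

Definition grid_point (z : {ffun 'I_p.+1 -> 'I_grid_size}) k : R :=
  (z k)%:R * delta - 2 * K.

Hypothesis K0 : 0 <= K.

Lemma grid_point_bound z k : `|grid_point z k| <= 2 * K.
Proof.
rewrite /grid_point ler_norml; apply/andP; split.
  by have : 0 <= (z k)%:R * delta by [rewrite mulr_ge0// ltW]; lra.
have : (z k)%:R <= 4 * K / delta.
  by rewrite -truncn_ge_nat ?divr_ge0 ?mulr_ge0 ?(ltW delta0)// -ltnS.
by rewrite ler_pdivlMr//; lra.
Qed.

(** Potentials only matter up to a constant, here fixed by psi_0 = 0; the
oscillation bound then puts all the weights into the box of the grid. *)
Lemma grid_approximation (psi : 'I_p.+1 -> R) :
  (forall j k, psi k - psi j <= 2 * K) ->
  exists z, forall k, `|psi k - grid_point z k - psi ord0| <= delta.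
Proof.
move=> osc; pose t k := (psi k - psi ord0 + 2 * K) / delta.
have t0 k : 0 <= t k by rewrite divr_ge0 ?(ltW delta0)//; have := osc k ord0; lra.
have tG k : (Num.truncn (t k) < grid_size)%N.
  rewrite ltnS le_truncn// ler_pM2r ?invr_gt0//; have := osc ord0 k; lra.
exists [ffun k => Ordinal (tG k)] => k; rewrite /grid_point ffunE /=.
have := truncn_itv (t0 k); rewrite {2 3}/t ler_pdivlMr// ltr_pdivrMr//.
rewrite -natr1 mulrDl mul1r => /andP[h1 h2]; rewrite ler_norml; lra.
Qed.

(** The bound G <= exp G is crude, but G is only of order sigma^-2. *)
Lemma card_grid_le : #|{ffun 'I_p.+1 -> 'I_grid_size}|%:R <=
  expR (p.+1%:R * grid_size%:R) :> R.
Proof.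
rewrite card_ffun !card_ord natrX expRM_natl lerXn2r ?nnegrE ?expR_ge0//.
by apply: le_trans (expR_ge1Dx _); rewrite lerDr.
Qed.

End grid.

Section deviation.
Context {R : realType} {d n p : nat}.
Variables (mu : probability 'rV[R]_d R) (x : 'I_n -> 'rV[R]_d).
Variables (y : 'I_p.+1 -> 'rV[R]_d) (b : 'I_p.+1 -> R) (r : R).
Hypothesis r0 : 0 < r.
Hypothesis n0 : (0 < n)%N.
Hypothesis mu_ball : mu (eball r) = 1%E.
Hypothesis y_ball : forall k, eball r (y k).
Implicit Types psi : 'I_p.+1 -> R.

(** Insensitive to adding a constant to the weights, because both terms are
averages of a probability measure. *)
Definition deviation psi : R :=
  \int[mu]_z max_affine y psi z - empirical_mean x (max_affine y psi).

Lemma deviation_dist psi psi' (c e : R) :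
  (forall k, `|psi k - psi' k - c| <= e) -> deviation psi <= deviation psi' + 2 * e.
Proof.
move=> h.
have dist z : `|max_affine y psi z - (max_affine y psi' z + c)| <= e.
  rewrite -(max_affine_shift y psi' c); apply: max_affine_dist => k.
  by rewrite opprD addrA.
have im q : mu.-integrable setT (EFin \o max_affine y q).
  exact: (integrable_max_affine r0 mu_ball y_ball).
have ci : mu.-integrable setT (EFin \o cst (c + e)).
  exact: (@bounded_integrable _ _ _ mu _ `|c + e|).
have h1 : \int[mu]_z max_affine y psi z <= \int[mu]_z max_affine y psi' z + (c + e).
  rewrite -[X in _ <= _ + X](Rintegral_probability_cst mu) -RintegralD//.
  apply: le_Rintegral => //; first exact: (integrableD measurableT (im psi') ci).
  by move=> z _; have := dist z; rewrite ler_norml => /andP[_]; lra.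
have nR : 0 < n%:R :> R by rewrite ltr0n.
have h2 : empirical_mean x (max_affine y psi') + (c - e) <=
    empirical_mean x (max_affine y psi).
  rewrite /empirical_mean -(ler_pM2l nR) mulrDr !mulrA mulfV ?gt_eqF// !mul1r.
  rewrite mulr_natl -[X in _ *+ X]card_ord -sumr_const -big_split /=.
  apply: ler_sum => i _.
  by have := dist (x i); rewrite ler_norml => /andP[]; lra.
rewrite /deviation; lra.
Qed.

(** The usual comparison in empirical risk minimisation: the empirical
objective of psi' is at most that of psi. *)
Lemma semidual_excess_le psi psi' :
  (forall psi'', empirical_mean x (max_affine y psi') - \sum_k psi' k * b k <=
     empirical_mean x (max_affine y psi'') - \sum_k psi'' k * b k) ->
  semidual mu y b psi' - semidual mu y b psi <= deviation psi' - deviation psi.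
Proof. by move=> min; have := min psi; rewrite /semidual /deviation; lra. Qed.

End deviation.

(** * Expected error of the estimator *)

Section expected_error.
Context {R : realType} {d p : nat} {dO : measure_display} {Omega : measurableType dO}.
Variables (P : probability Omega R) (mu nu : probability 'rV[R]_d R).
Variables (y : 'I_p.+1 -> 'rV[R]_d) (b : 'I_p.+1 -> R) (M r : R).
Variables (n : nat) (X : 'I_n -> {RV P >-> 'rV[R]_d}).
Variables (phi : 'rV[R]_d -> \bar R) (That : Omega -> 'rV[R]_d -> 'rV[R]_d).
Hypothesis d0 : (0 < d)%N.
Hypothesis n0 : (0 < n)%N.
Hypothesis M0 : 0 <= M.
Hypothesis r0 : 0 < r.
Hypothesis mu_ball : mu (eball r) = 1%E.
Hypothesis mu_le : forall A, measurable A -> (mu A <= M%:E * lebesgue_rV d A)%E.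
Hypothesis y_ball : forall k, eball r (y k).
Hypothesis b_gt0 : forall k, 0 < b k.
Hypothesis nuE : forall A, measurable A -> nu A = (\sum_k (b k)%:E * \d_(y k) A)%E.
Hypothesis iidX : iid_sample mu X.
Hypothesis phi_opt : optimal_brenier_potential mu nu phi.
Hypothesis That_est :
  forall w, monge_map_estimator (fun=> n%:R^-1) (fun i => X i w) b y (That w).

Let K : R := d%:R * r ^+ 2.
Let A : R := 2 * (M * (4 * r * (2 * r) ^+ d.-1)).

Lemma sample_in_ball :
  exists N, [/\ measurable N, P N = 0%E & forall w, ~ N w -> forall i, eball r (X i w)].
Proof.
have mb : measurable (~` @eball R d r) by apply: measurableC; exact: eball_measurable.
have mX i : measurable (X i @^-1` (~` eball r)).
  by rewrite -[X in measurable X]setTI; exact: measurable_funP.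
have mU : measurable (\bigcup_(i in [set: 'I_n]) (X i @^-1` (~` eball r))).
  by apply: fin_bigcup_measurable => // i _; exact: mX.
exists (\bigcup_(i in [set: 'I_n]) (X i @^-1` (~` eball r))); split => //.
  apply/eqP; rewrite -measure_le0.
  have := @content_sub_fsum _ _ _ P _ [set: 'I_n] _
    (fun i => X i @^-1` (~` eball r)) finite_finset.
  move=> /(_ _ _ mU (@subset_refl _ _)); rewrite fsbig1//.
    by apply => i _; exact: mX.
  by move=> i _; have [_ law] := iidX; rewrite [LHS](law i _ mb); exact: eball_full.
move=> w wN i; apply: contrapT => h; apply: wN; exists i => //.
Qed.

Lemma expected_error_le (e h : R) (F : Omega -> R) psi (g : Omega -> 'I_p.+1 -> R) :
  0 < h -> measurable_fun setT F -> (forall w, 0 <= F w) ->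
  (forall psi', semidual mu y b psi <= semidual mu y b psi') ->
  (exists N, [/\ measurable N, mu N = 0%E & forall x, ~ N x ->
     exists k, max_affine y psi x = affine y psi k x /\ grad phi x = y k]) ->
  (forall w x, subgradient y (g w) x (That w x)) ->
  (forall w, (forall i, eball r (X i w)) ->
     semidual mu y b (g w) - semidual mu y b psi <= F w) ->
  (\int[P]_w (F w)%:E <= e%:E)%E ->
  (\int[P]_w \int[mu]_x (enorm (grad phi x - That w x))%:E <=
    (d%:R * (e / h + A * h))%:E)%E.
Proof.
move=> h0 mF F0 min gradE sT exc Fe.
have A0 : 0 <= A by rewrite /A !mulr_ge0// ?exprn_ge0 ?mulr_ge0// ltW.
have hi0 : 0 <= h^-1 by rewrite invr_ge0 ltW.
have Ah0 : 0 <= A * h by rewrite mulr_ge0// ltW.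
have [N [mN N0 NX]] := sample_in_ball.
pose Q w := d%:R * (h^-1 * F w + A * h).
have Q0 w : 0 <= Q w.
  by rewrite mulr_ge0// addr_ge0// mulr_ge0.
have mQ : measurable_fun setT Q.
  apply: measurable_funM => //; apply: measurable_funD => //.
  exact: measurable_funM.
apply: (@le_trans _ _ (\int[P]_w (Q w)%:E)%E).
  apply: (@ae_le_integralT _ _ _ P _ _ N) => //.
  - exact/measurable_EFinP.
  - by move=> w; apply: integral_ge0 => x _; rewrite lee_fin sqrtr_ge0.
  move=> w wN.
  apply: le_trans (map_stability M0 r0 mu_ball mu_le y_ball h0 min gradE (sT w)) _.
  rewrite lee_fin ler_wpM2l// -/A lerD2r mulrC ler_wpM2l//.
  by apply: exc; exact: NX.
have -> : (fun w => (Q w)%:E) =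
    (fun w => d%:R%:E * (h^-1%:E * (F w)%:E + (A * h)%:E))%E by [].
rewrite ge0_integralZl//; first last.
- by move=> w _; rewrite -EFinM -EFinD lee_fin addr_ge0// mulr_ge0.
- by apply: emeasurable_funD => //; apply: emeasurable_funM => //; exact/measurable_EFinP.
rewrite [leRHS]EFinM lee_wpmul2l ?lee_fin//.
rewrite ge0_integralD//; first last.
- by apply: emeasurable_funM => //; exact/measurable_EFinP.
- by move=> w _; rewrite -EFinM lee_fin mulr_ge0.
rewrite integral_cst// [X in (_ + _ * X)%E]probability_setT mule1 EFinD leeD2r//.
rewrite ge0_integralZl//; first last.
- by move=> w _; rewrite lee_fin.
- exact/measurable_EFinP.
by rewrite [(e / h)%R]mulrC [leRHS]EFinM lee_wpmul2l// lee_fin invr_ge0 ltW.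
Qed.

(** For sigma <= 1 the deviation of the estimated weights is controlled on a
grid of mesh sigma^2, with exponential parameter s of order sigma^2 and step
h = sigma: the class has at most exp (m G) points with G of order sigma^-2,
and m = n sigma^8. For sigma > 1 the deviations are bounded outright and
h = 1 is enough. *)
Lemma expected_error_rate (sigma : R) : 0 < sigma ->
  sigma ^+ 8 = p.+1%:R / n%:R ->
  (\int[P]_w \int[mu]_x (enorm (grad phi x - That w x))%:E <=
    (d%:R * (16 * K * (4 * K + 2) + 8 * K + 2 + A) * sigma)%:E)%E.
Proof.
move=> s0 s8.
have K0 : 0 < K by rewrite mulr_gt0 ?ltr0n// exprn_gt0.
have A0 : 0 <= A by rewrite /A !mulr_ge0// ?exprn_ge0 ?mulr_ge0// ltW.
have nR : 0 < n%:R :> R by rewrite ltr0n.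
have [psi [phi_ge [N [mN N0 NE]] min]] :=
  optimal_potential_max_affine r0 mu_ball y_ball b_gt0 nuE phi_opt.
have [[pr lphi cphi] _] := phi_opt.
have gradE : exists N, [/\ measurable N, mu N = 0%E & forall x, ~ N x ->
    exists k, max_affine y psi x = affine y psi k x /\ grad phi x = y k].
  have [N' [mN' N'0 N'E]] := grad_max_affine_ae cphi phi_ge
    (lower_semicontinuous_measurable_rV lphi) M0 (ltW r0) mu_le (cube_full r0 mu_ball).
  exists (N `|` N'); split; first exact: measurableU.
    by rewrite measureU0.
  by move=> x /not_orP[xN xN']; apply: N'E => //; exact: NE.
have [fg fgP] := choice That_est.
have [g gP] := choice fgP.
pose u w := legendre_weights y (g w).
have sT w x : subgradient y (u w) x (That w x).
  by apply: subdifferential_dual; have [_ h] := gP w; exact: h.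
have umin w (psi'' : 'I_p.+1 -> R) :
    empirical_mean (X ^~ w) (max_affine y (u w)) - \sum_k u w k * b k <=
    empirical_mean (X ^~ w) (max_affine y psi'') - \sum_k psi'' k * b k.
  by have [og _] := gP w; apply: (dual_optimal_minimiser psi'' og).
have osc : forall j k, psi k - psi j <= 2 * K.
  apply: (minimiser_oscillation y_ball b_gt0
    (ave := fun q => \int[mu]_x max_affine y q x)) => // q1 q2 h.
  apply: (@eq_Rintegral_full _ _ _ mu (eball r)) => //; try exact: measurable_max_affine.
    exact: eball_measurable.
  exact: eball_full.
have uosc w : (forall i, eball r (X i w)) -> forall j k, u w k - u w j <= 2 * K.
  move=> wX; apply: (minimiser_oscillation y_ball b_gt0
    (ave := fun q => empirical_mean (X ^~ w) (max_affine y q))) => // q1 q2 h.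
  by rewrite /empirical_mean; congr (_ * _); apply: eq_bigr => i _; exact: h.
have exc w : semidual mu y b (u w) - semidual mu y b psi <=
    deviation mu (X ^~ w) y (u w) - deviation mu (X ^~ w) y psi.
  exact: semidual_excess_le.
have [s1|s1] := leP sigma 1; last first.
  apply: (@le_trans _ _ (d%:R * (8 * K / 1 + A * 1))%:E).
    apply: (@expected_error_le _ _ (cst (8 * K)) psi u) => //.
    - by move=> w /=; rewrite mulr_ge0// ltW.
    - move=> w wX; apply: le_trans (exc w) _; rewrite lerBlDl /=.
      have -> : 8 * K = 2 * (4 * K) by lra.
      apply: (@deviation_dist _ _ _ _ mu _ y r r0 n0 mu_ball y_ball _ _
        (u w ord0 - psi ord0)) => k; rewrite ler_norml.
      have := uosc w wX k ord0; have := uosc w wX ord0 k.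
      have := osc k ord0; have := osc ord0 k; lra.
    - rewrite [leLHS](integral_cst P measurableT (8 * K)%:E).
      by rewrite [X in (_ * X)%E]probability_setT mule1.
  rewrite lee_fin -[leRHS]mulrA ler_wpM2l//.
  have q0 : 0 <= 16 * K * (4 * K + 2) by rewrite !mulr_ge0 ?addr_ge0 ?mulr_ge0// ltW.
  apply: (@le_trans _ _ (16 * K * (4 * K + 2) + 8 * K + 2 + A)); first lra.
  by rewrite ler_peMr ?(ltW s1)//; lra.
pose delta := sigma ^+ 2.
have delta0 : 0 < delta by rewrite exprn_gt0.
(* With B = 4 K, this choice gives 4 s B = delta. *)
pose s := delta / (16 * K).
pose G := grid_size K delta.
pose h z x := max_affine y (grid_point (K := K) (delta := delta) z) x -
  max_affine y (fun k => psi k - psi ord0) x.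
have mh z : measurable_fun setT (h z).
  by apply: measurable_funB; exact: measurable_max_affine.
have hB z x : `|h z x| <= 4 * K.
  apply: max_affine_dist => k.
  have := grid_point_bound delta0 (ltW K0) z k; rewrite !ler_norml.
  have := osc k ord0; have := osc ord0 k; lra.
have sB : 4 * s * (4 * K) <= 1.
  have -> : 4 * s * (4 * K) = delta.
    by rewrite /s; field; exact: lt0r_neq0.
  by rewrite /delta exprn_ile1// ltW.
have sgt0 : 0 < s by rewrite divr_gt0// mulr_gt0.
have B0 : 0 < 4 * K by rewrite mulr_gt0.
have beta1 : 1 <= p.+1%:R * G%:R :> R.
  by rewrite -natrM -[X in X <= _]/(1%:R) ler_nat muln_gt0.
have [F [mF F0 hF EF]] := empirical_process_bound iidX n0 sgt0 B0 sB mh hB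
  (card_grid_le K delta) beta1.
pose e := (p.+1%:R * G%:R + n%:R * (9 * (s * (4 * K)) ^+ 2)) / (n%:R * s) + 2 * delta.
have im q : mu.-integrable setT (EFin \o max_affine y q).
  exact: (integrable_max_affine r0 mu_ball y_ball).
have Fe : (\int[P]_w (F w + 2 * delta)%:E <= e%:E)%E.
  under eq_integral do rewrite EFinD.
  rewrite ge0_integralD//; first last.
  - by move=> w _; rewrite lee_fin mulr_ge0// ltW.
  - exact/measurable_EFinP.
  - by move=> w _; rewrite lee_fin.
  rewrite integral_cst// [X in (_ + _ * X)%E]probability_setT mule1.
  by rewrite /e EFinD leeD2r.
apply: (@le_trans _ _ (d%:R * (e / sigma + A * sigma))%:E).
  apply: (@expected_error_le e sigma (fun w => F w + 2 * delta) psi u) => //.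
  - exact: measurable_funD.
  - by move=> w; rewrite addr_ge0// mulr_ge0// ltW.
  move=> w wX; apply: le_trans (exc w) _.
  have [z zP] := grid_approximation delta0 (uosc w wX).
  have D1 := deviation_dist (X ^~ w) r0 n0 mu_ball y_ball zP.
  have D2 : deviation mu (X ^~ w) y (fun k => psi k - psi ord0) <=
      deviation mu (X ^~ w) y psi + 2 * 0.
    apply: (@deviation_dist _ _ _ _ mu _ y r r0 n0 mu_ball y_ball _ _
      (- psi ord0)) => k.
    by rewrite [psi k - _]addrC addrK subrr normr0.
  have D3 : \int[mu]_x h z x - n%:R^-1 * \sum_i h z (X i w) =
      deviation mu (X ^~ w) y (grid_point z) -
      deviation mu (X ^~ w) y (fun k => psi k - psi ord0).
    rewrite /h RintegralB ?im// sumrB mulrBr /deviation /empirical_mean; lra.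
  have := hF z w; rewrite D3; lra.
rewrite lee_fin -[leRHS]mulrA ler_wpM2l//.
suff eP : e <= (16 * K * (4 * K + 2) + 2) * delta.
  have : e / sigma <= (16 * K * (4 * K + 2) + 2) * sigma.
    by rewrite ler_pdivrMr// (le_trans eP)// /delta expr2 mulrA.
  have := mulr_gt0 K0 s0; lra.
have delta1 : delta <= 1 by rewrite /delta exprn_ile1// ltW.
have GP : G%:R * delta <= 4 * K + 1.
  have := truncn_itv (divr_ge0 (mulr_ge0 (ler0n R 4) (ltW K0)) (ltW delta0)).
  move=> /andP[+ _]; rewrite ler_pdivlMr// /G /grid_size -natr1; lra.
have mE : p.+1%:R = n%:R * delta ^+ 4 :> R.
  by rewrite /delta -exprM s8 mulrC divfK// gt_eqF.
have s4 : s * (4 * K) = delta / 4.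
  by rewrite /s; field; exact: lt0r_neq0.
rewrite /e [leRHS]mulrDl lerD2r.
have ns0 : 0 < n%:R * s by exact: mulr_gt0.
rewrite s4 ler_pdivrMr// mE.
have -> : 16 * K * (4 * K + 2) * delta * (n%:R * s) = n%:R * ((4 * K + 2) * delta ^+ 2).
  by rewrite /s; field; exact: lt0r_neq0.
rewrite -mulrA -mulrDr ler_wpM2l//.
have d3 : delta ^+ 3 <= delta ^+ 2 by rewrite exprSr ler_piMr// exprn_ge0// ltW.
have d30 : 0 <= delta ^+ 3 by rewrite exprn_ge0// ltW.
have -> : delta ^+ 4 * G%:R = delta ^+ 3 * (G%:R * delta).
  by rewrite exprSr -mulrA [delta * _]mulrC.
have := ler_wpM2l d30 GP; nra.
Qed.

End expected_error.

Theorem theorem3p14 (R : realType) (M r : R) (d : nat) :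
  0 < M -> 0 < r -> (0 < d)%N ->
  exists2 C : R, 0 < C &
  forall (mu nu : probability 'rV[R]_d R)
    (m : nat) (b : 'I_m -> R) (y : 'I_m -> 'rV[R]_d),
  mu (eball r) = 1%E ->
  nu (eball r) = 1%E ->
  (exists2 rho, is_density mu rho & forall x, rho x <= M) ->
  (1 < m)%N ->
  (forall j, 0 < b j) ->
  \sum_(j < m) b j = 1 ->
  (forall A, measurable A -> nu A = (\sum_(j < m) (b j)%:E * \d_(y j) A)%E) ->
  forall (dO : measure_display) (Omega : measurableType dO)
    (P : probability Omega R) (n : nat) (X : 'I_n -> {RV P >-> 'rV[R]_d}),
  (0 < n)%N ->
  iid_sample mu X ->
  forall (phi : 'rV[R]_d -> \bar R) (That : Omega -> 'rV[R]_d -> 'rV[R]_d),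
  optimal_brenier_potential mu nu phi ->
  (forall w, monge_map_estimator (fun=> n%:R^-1) (fun i => X i w) b y (That w)) ->
  (\int[P]_w \int[mu]_x (enorm (grad phi x - That w x))%:E
    <= (C * (m%:R / n%:R) `^ 8^-1)%:E)%E.
Proof.
move=> M0 r0 d0; pose K := d%:R * r ^+ 2.
have K0 : 0 < K by rewrite mulr_gt0 ?ltr0n// exprn_gt0.
pose A := 2 * (M * (4 * r * (2 * r) ^+ d.-1)).
have A0 : 0 < A by rewrite /A !mulr_gt0// exprn_gt0// mulr_gt0.
exists (d%:R * (16 * K * (4 * K + 2) + 8 * K + 2 + A)).
  rewrite mulr_gt0 ?ltr0n//.
  have : 0 < 16 * K * (4 * K + 2) by apply: mulr_gt0; lra.
  lra.
move=> mu nu [//|p] b y mu_ball nu_ball [rho mu_rho rhoM] _ b0 _ nuE.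
move=> dO Omega P n X n0 iidX phi That phi_opt That_est.
have mn0 : 0 < p.+1%:R / n%:R :> R by rewrite divr_gt0 ?ltr0n.
apply: (expected_error_rate d0 n0 (ltW M0) r0 mu_ball
  (density_measure_le mu_rho rhoM) (discrete_support r0 nu_ball b0 nuE)
  b0 nuE iidX phi_opt That_est).
- exact: powR_gt0.
- by rewrite -powR_mulrn ?powR_ge0// -powRrM mulVf// powRr1// ltW.
Qed.
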